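(* Let $Q$ be a quiver whose underlying graph is a simply-laced Dynkin diagram, $k$ a field, $w$ a $c_Q$-sortable element of the Weyl group $W$, and $\mathcal{F}_Q(w)$ the corresponding torsion-free class in $\operatorname{mod} kQ$. Then taking dimension vectors, $M\mapsto\underline{\dim}\,M$, gives a bijection from the set of isomorphism classes of simple objects in $\mathcal{F}_Q(w)$ to the set of Bruhat inversions of $w$.
   Context: Setting: $Q=(Q_0,Q_1)$ is a quiver whose underlying graph is a Dynkin diagram of type $X\in\{A_n,D_n,E_6,E_7,E_8\}$; $\Phi$ is the root system of type $X$ in its ambient space $V$ with fixed simple roots $\alpha_i$ ($i\in Q_0$), simple reflections $s_i$, positive/negative roots $\Phi^{\pm}$, Weyl group $W$ with length function $\ell$; $t_\beta$ is the reflection with respect to a root $\beta$. $\operatorname{mod} kQ$ is the category of finitely generated right $kQ$-modules, identified with finite-dimensional representations of $Q$ (paths are composed left to right). $\underline{\dim}\,M=\sum_i m_i\alpha_i\in V$, where $m_i$ is the multiplicity of the simple module at $i$ in $M$. By Gabriel's theorem, $\underline{\dim}$ gives a bijection from isomorphism classes of indecomposable $kQ$-modules to $\Phi^+$. Coxeter-sortable elements: the Coxeter element $c_Q$ is $c_Q=s_{u_1}\cdots s_{u_n}$ with $Q_0=\{u_1,\dots,u_n\}$, $n=\#Q_0$, such that whenever there is an arrow $i\leftarrow j$ in $Q$, $s_i$ appears before $s_j$. An element $w\in W$ is $c_Q$-sortable if it has a reduced expression $w=c^{(0)}c^{(1)}\cdots c^{(m)}$ where each $c^{(i)}$ is a subword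 of $c_Q$ and the sets of letters satisfy $\operatorname{supp}(c^{(0)})\supset\operatorname{supp}(c^{(1)})\supset\cdots\supset\operatorname{supp}(c^{(m)})$. Inversions: $\operatorname{inv}(w)=\Phi^+\cap w(\Phi^-)$. A positive root $\beta$ is a Bruhat inversion of $w$ if $\ell(t_\beta w)=\ell(w)-1$. $\mathcal{F}_Q(w)$: the full subcategory of $\operatorname{mod} kQ$ of finite direct sums of indecomposable modules $M$ with $\underline{\dim}\,M\in\operatorname{inv}(w)$. For $c_Q$-sortable $w$ it is a torsion-free class in $\operatorname{mod}kQ$, i.e. closed under submodules and extensions (Ingalls–Thomas). Simple objects: a nonzero $M\in\mathcal{F}_Q(w)$ is a simple object in $\mathcal{F}_Q(w)$ if there is no submodule $L$ of $M$ with $0\neq L\neq M$ and $L,M/L\in\mathcal{F}_Q(w)$. *)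

(* Defs.v *)
From HB Require Import structures.
From mathcomp Require Import all_boot all_order all_algebra.
From mathcomp Require Import boolp reals.

Set Implicit Arguments.
Unset Strict Implicit.
Unset Printing Implicit Defensive.

Import Order.TTheory GRing.Theory Num.Theory.
Local Open Scope ring_scope.

Record quiver := Quiver {
  vertex : finType;
  arrow : finType;
  source : arrow -> vertex;
  target : arrow -> vertex }.

(* On the vertices 0, ..., n-1, every diagram is drawn as the path
   0 - 1 - ... - (n-2) together with an edge from n-1 to [dynkin_joint]. *)
Inductive dynkin := DynA of nat | DynD of nat | DynE6 | DynE7 | DynE8.

Definition dynkin_valid (X : dynkin) : bool :=
  match X with DynA n => (1 <= n)%N | DynD n => (4 <= n)%N | _ => true end.

Definition dynkin_rank (X : dynkin) : nat :=
  match X with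
  | DynA n => n | DynD n => n | DynE6 => 6 | DynE7 => 7 | DynE8 => 8
  end%N.

Definition dynkin_joint (X : dynkin) : nat :=
  match X with DynA n => n - 2 | DynD n => n - 3 | _ => 2 end%N.

Definition dynkin_edge (X : dynkin) (i j : nat) : bool :=
  ((i < j) &&
   (if j.+1 == dynkin_rank X then i == dynkin_joint X else j == i.+1))%N.

Definition dynkin_adj (X : dynkin) : rel 'I_(dynkin_rank X) :=
  fun i j => dynkin_edge X i j || dynkin_edge X j i.

Definition cartan (X : dynkin) (i j : 'I_(dynkin_rank X)) : int :=
  if i == j then 2 else - (dynkin_adj i j : nat)%:Z.

(* phi identifies the underlying graph of Q with the diagram X; the case i = j
   excludes loops. *)
Definition underlying_dynkin (Q : quiver) (X : dynkin)
    (phi : vertex Q -> 'I_(dynkin_rank X)) : Prop :=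
  [/\ dynkin_valid X,
      bijective phi
    & forall i j : vertex Q,
        #|[set a : arrow Q | ((source a == i) && (target a == j))
                             || ((source a == j) && (target a == i))]|
        = dynkin_adj (phi i) (phi j) :> nat].

Section Representations.

Variables (k : fieldType) (Q : quiver).

(* A right kQ-module M (paths composed left to right) amounts to the spaces
   M e_i and, for a : i -> j, the maps M e_i -> M e_j given by the right
   action of a. *)
Record rep := Rep {
  rep_space :> vertex Q -> vectType k;
  rep_map : forall a : arrow Q,
    'Hom(rep_space (source a), rep_space (target a)) }.

Definition rep_hom (M N : rep) (f : forall i, 'Hom(M i, N i)) : Prop :=
  forall a : arrow Q,
    (f (target a) \o rep_map M a)%VF = (rep_map N a \o f (source a))%VF.

Definition rep_iso (M N : rep) : Prop :=
  exists (f : forall i, 'Hom(M i, N i)) (g : forall i, 'Hom(N i, M i)),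
    [/\ rep_hom f, rep_hom g,
        forall i, (g i \o f i)%VF = \1%VF
      & forall i, (f i \o g i)%VF = \1%VF].

Definition rep_is0 (M : rep) : Prop := forall i, \dim {: M i} = 0%N.

Definition rep0 : rep := @Rep (fun=> 'rV[k]_0) (fun=> 0%VF).

Definition pair_map (U V U' V' : vectType k) (f : 'Hom(U, V))
    (g : 'Hom(U', V')) (u : U * U') : V * V' := (f u.1, g u.2).

Lemma pair_map_is_linear (U V U' V' : vectType k) (f : 'Hom(U, V))
  (g : 'Hom(U', V')) : linear (pair_map f g).
Proof. by move=> c u v; rewrite /pair_map /= !linearP. Qed.

HB.instance Definition _ (U V U' V' : vectType k) (f : 'Hom(U, V))
    (g : 'Hom(U', V')) :=
  GRing.isLinear.Build k (U * U')%type (V * V')%type _ (pair_map f g)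
    (pair_map_is_linear f g).

Definition rep_sum (M N : rep) : rep :=
  @Rep (fun i => (M i * N i)%type)
       (fun a => linfun (pair_map (rep_map M a) (rep_map N a))).

Definition rep_bigsum (s : seq rep) : rep := foldr rep_sum rep0 s.

Definition indecomposable (M : rep) : Prop :=
  ~ rep_is0 M /\
  forall A B : rep, rep_iso M (rep_sum A B) -> rep_is0 A \/ rep_is0 B.

Record subrep (M : rep) := Subrep {
  sub_space :> forall i, {vspace M i};
  sub_stable : forall a : arrow Q,
    (rep_map M a @: sub_space (source a) <= sub_space (target a))%VS }.

Definition rep_of_sub (M : rep) (L : subrep M) : rep :=
  @Rep (fun i => subvs_of (L i))
       (fun a => linfun (vsproj (L (target a))) \o rep_map M a \o linfun vsval)%VF.

(* The quotient of a vector space V by U is realized on the complement U^C,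
   with projection [quot_proj]: V -> U^C along U; see [quot_proj_surj],
   [lker_quot_proj] and [quot_proj_hom]. *)
Definition quot_proj (V : vectType k) (U : {vspace V}) :
    'Hom(V, subvs_of U^C) :=
  (linfun (vsproj U^C) \o (\1 - projv U))%VF.

Definition rep_quot (M : rep) (L : subrep M) : rep :=
  @Rep (fun i => subvs_of (L i)^C)
       (fun a => quot_proj (L (target a)) \o rep_map M a \o linfun vsval)%VF.

Lemma quot_projE (V : vectType k) (U : {vspace V}) (v : V) :
  vsval (quot_proj U v) = v - projv U v.
Proof.
rewrite comp_lfunE lfunE /= add_lfunE opp_lfunE id_lfunE vsprojK //.
have vUC : v \in (U + U^C)%VS by rewrite addv_complf memvf.
rewrite -[X in X - _](daddv_pi_add (capv_compl U) vUC).
by rewrite addrAC subrr add0r memv_pi.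
Qed.

Lemma lker_quot_proj (V : vectType k) (U : {vspace V}) :
  lker (quot_proj U) = U.
Proof.
apply/vspaceP=> v; rewrite memv_ker; apply/eqP/idP => [v0|vU].
  have /eqP := quot_projE U v; rewrite v0 /= eq_sym subr_eq0 => /eqP->.
  exact: memv_proj.
by apply: val_inj; rewrite /= quot_projE projv_id ?subrr.
Qed.

Lemma quot_proj_eq (V : vectType k) (U : {vspace V}) (u v : V) :
  u - v \in U -> quot_proj U u = quot_proj U v.
Proof.
by rewrite -{1}(lker_quot_proj U) memv_ker linearB subr_eq0 => /eqP.
Qed.

Lemma quot_proj_surj (V : vectType k) (U : {vspace V}) :
  cancel (linfun vsval) (quot_proj U).
Proof.
move=> w; apply: val_inj; rewrite /= quot_projE lfunE /=.
suff -> : projv U (vsval w) = 0 by rewrite subr0.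
have UC0 : (U^C :&: U)%VS = 0%VS by rewrite capvC capv_compl.
have wUC : vsval w \in (U + U^C)%VS by rewrite addv_complf memvf.
have := daddv_pi_add (capv_compl U) wUC.
by rewrite (daddv_pi_id UC0) ?subvsP // => /(canRL (addrK _)); rewrite subrr.
Qed.

Lemma quot_proj_hom (M : rep) (L : subrep M) :
  @rep_hom M (rep_quot L) (fun i => quot_proj (L i)).
Proof.
move=> a; apply/lfunP=> v; rewrite /= comp_lfunE.
rewrite (comp_lfunE _ (quot_proj (L (source a)))) (comp_lfunE _ (linfun vsval)).
rewrite (comp_lfunE (quot_proj _)) [linfun vsval _]lfunE /=.
apply: quot_proj_eq; rewrite -linearB quot_projE subKr.
by apply: (subvP (sub_stable L a)); rewrite memv_img ?memv_proj.
Qed.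

(* F should be stable under isomorphism, [rep_quot] being one model of the
   quotient. *)
Definition simple_object (F : rep -> Prop) (M : rep) : Prop :=
  [/\ F M, ~ rep_is0 M
    & ~ exists L : subrep M,
        [/\ ~ (forall i, L i = 0%VS), ~ (forall i, L i = fullv),
            F (rep_of_sub L) & F (rep_quot L)]].

(* Q being acyclic, the simple kQ-modules are one-dimensional and concentrated
   at a single vertex, so the multiplicity of the one at i is dim M_i. *)
Definition dimvec (R : realType) (V : vectType R) (alpha : vertex Q -> V)
    (M : rep) : V :=
  \sum_(i : vertex Q) (\dim {: M i})%:R *: alpha i.

(* Objects of the full subcategory of finite direct sums of indecomposable
   modules whose dimension vector lies in S. *)
Definition add_dimvec (R : realType) (V : vectType R) (alpha : vertex Q -> V)
    (S : V -> Prop) (M : rep) : Prop :=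
  exists (n : nat) (N : 'I_n -> rep),
    (forall m, indecomposable (N m) /\ S (dimvec alpha (N m))) /\
    rep_iso M (rep_bigsum [seq N m | m <- enum 'I_n]).

End Representations.

Section RootSystem.

Variables (R : realType) (V : vectType R) (form : {dot V for idfun}).

Definition cartan_number (x y : V) : R := 2 * form x y / form y y.

Definition refl_fun (b x : V) : V := x - cartan_number x b *: b.

Lemma refl_fun_is_linear (b : V) : linear (refl_fun b).
Proof.
move=> a x y; rewrite /refl_fun /cartan_number linearDl linearZl_LR /=.
by rewrite mulrDr mulrDl scalerDl opprD scalerBr scalerA mulrCA -!mulrA addrACA.
Qed.

HB.instance Definition _ (b : V) :=
  GRing.isLinear.Build R V V _ (refl_fun b) (refl_fun_is_linear b).

Definition refl (b : V) : 'End(V) := linfun (refl_fun b).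

Definition is_root_system (Phi : seq V) : Prop :=
  [/\ 0 \notin Phi /\ <<Phi>>%VS = fullv,
      forall (a : V) (c : R), a \in Phi -> c *: a \in Phi -> c = 1 \/ c = -1,
      forall a b, a \in Phi -> b \in Phi -> refl a b \in Phi
    & forall a b, a \in Phi -> b \in Phi -> cartan_number b a \is a Num.int].

Variables (I : finType) (alpha : I -> V) (Phi : seq V).

Definition pos_root (b : V) : Prop :=
  b \in Phi /\ exists c : I -> nat, b = \sum_i (c i)%:R *: alpha i.

Definition neg_root (b : V) : Prop :=
  b \in Phi /\ exists c : I -> nat, b = - \sum_i (c i)%:R *: alpha i.

Definition is_simple_system : Prop :=
  [/\ injective alpha /\ (forall i, alpha i \in Phi),
      basis_of fullv [seq alpha i | i <- enum I]
    & forall b, b \in Phi -> pos_root b \/ neg_root b].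

Definition word_prod (s : seq I) : 'End(V) :=
  foldr (fun i w => (refl (alpha i) \o w)%VF) \1%VF s.

Definition weyl (w : 'End(V)) : Prop := exists s : seq I, word_prod s = w.

Definition has_word (w : 'End(V)) (n : nat) : bool :=
  [exists s : n.-tuple I, word_prod s == w].

(* The value outside of the Weyl group is irrelevant. *)
Definition weyl_length (w : 'End(V)) : nat :=
  match pselect (exists n, has_word w n) with
  | left e => ex_minn e
  | right _ => 0%N
  end.

Definition inversion (w : 'End(V)) (b : V) : Prop :=
  pos_root b /\ exists2 g, neg_root g & b = w g.

Definition bruhat_inversion (w : 'End(V)) (b : V) : Prop :=
  pos_root b /\ weyl_length w = (weyl_length (refl b \o w)%VF).+1.

(* cs lists the subwords c^(0), ..., c^(m) of the word c. *)
Definition sortable (c : seq I) (w : 'End(V)) : Prop :=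
  weyl w /\
  exists cs : seq (seq I),
    [/\ all (fun s => subseq s c) cs,
        sorted (fun s t : seq I => all (mem s) t) cs,
        word_prod (flatten cs) = w
      & size (flatten cs) = weyl_length w].

End RootSystem.

(* A word u_1 ... u_n for the Coxeter element of Q: for every arrow
   target <- source, the target comes first. *)
Definition coxeter_word (Q : quiver) (c : seq (vertex Q)) : Prop :=
  [/\ uniq c, forall i, i \in c
    & forall a : arrow Q, (index (target a) c < index (source a) c)%N].

(* The simple roots are indexed by the vertices of Q through phi. *)
Definition simple_roots_of_type (R : realType) (V : vectType R)
    (form : {dot V for idfun}) (I : finType) (alpha : I -> V) (X : dynkin)
    (phi : I -> 'I_(dynkin_rank X)) : Prop :=
  forall i j : I,
    cartan_number form (alpha i) (alpha j) = (cartan (phi i) (phi j))%:~R.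

(* The category F_Q(w) is identified with its class of objects. *)
Definition FQ (k : fieldType) (Q : quiver) (R : realType) (V : vectType R)
    (alpha : vertex Q -> V) (Phi : seq V) (w : 'End(V)) : rep k Q -> Prop :=
  add_dimvec alpha (inversion alpha Phi w).

(* Main.v *)
(* The positive roots x <> b with t_b x < 0 satisfy t_b x = x - b, so they come
   in pairs of sum b, and comparing the inversions of w and t_b w on each pair
   shows: b is a Bruhat inversion of w iff it is an inversion of w which is not
   a sum of two inversions of w.

   A sortable word starts at a sink u of Q, and its tail is adapted in the same
   sense to the quiver reflected at u.  Reflection at u exchanges the
   indecomposables other than the simple S_u, so induction along the word shows
   that every inversion is the dimension vector of an indecomposable and that
   an indecomposable which embeds into an object of F_Q(w) lies in F_Q(w).
   Hence a nonzero, non-injective map M -> N in F_Q(w) prevents M from being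
   simple: its kernel and image are in F_Q(w).

   If M is indecomposable of dimension b = g + d with g, d inversions, then
   1 = <b, b> = <b, g> + <b, d> for the Euler form, so M has a nonzero map to
   the module of dimension g or d, which cannot be injective: M is not simple.
   Conversely an exact sequence in F_Q(w) ending the simplicity of M writes b as
   a sum of several inversions, and one of them, g, has (b, g) > 0, whence
   b = g + (b - g).  Two simple objects of dimension b have a nonzero map
   between them since <b, b> = 1, and it is injective by simplicity. *)

Require Import Defs.
From HB Require Import structures.
From mathcomp Require Import all_boot all_order all_algebra.
From mathcomp Require Import boolp reals ring lra zify.

Set Implicit Arguments.
Unset Strict Implicit.
Unset Printing Implicit Defensive.

Import Order.TTheory GRing.Theory Num.Theory.
Local Open Scope ring_scope.

(** * Linear algebra *)

(** A sortable word may omit letters, so its letters need not be genuine sinks: for a single arrow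
    from 2 to 1, the one-letter word 2 is sortable although 2 is a source. What survives is that, in
    the orientation current when a letter is read, no arrow leads from it to itself or to a letter
    of the remaining word ([admissible]). Modules attached to a word vanish outside its letters
    ([edimvec_supp]), so each letter is a sink on their support ([esink]), and this is enough to
    reflect. Reflection is a relation between two representations ([reflects]), read downwards along
    the word to prove closure under subobjects and upwards to construct modules. The simple module
    at the sink has no reflection. Upwards it is excluded by the positivity of the roots of a
    reduced word; downwards, by testing only vectors away from the sink, which no map to that simple
    module detects. This is why closure is proved for modules whose points are separated by
    homomorphisms into the class, and not directly for submodules of a direct sum. *)

Lemma ex_lfun (k : fieldType) (aT rT : vectType k) (f : aT -> rT) :
  linear f -> {g : 'Hom(aT, rT) | g =1 f}.
Proof.
move=> lf; pose F : {linear aT -> rT} := HB.pack f (GRing.isLinear.Build _ _ _ _ f lf).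
by exists (linfun F) => x; rewrite lfunE.
Qed.

(** Values are chosen on a basis of [U] and extended linearly. As [P] need not be functional, a
    diagram chase can be made linear without first proving that its result is unique. *)
Lemma linear_choice (k : fieldType) (aT rT : vectType k) (U : {vspace aT})
    (P : aT -> rT -> Prop) :
  (forall c x1 y1 x2 y2, P x1 y1 -> P x2 y2 ->
     P (c *: x1 + x2) (c *: y1 + y2)) ->
  (forall x, x \in U -> exists y, P x y) ->
  exists h : 'Hom(aT, rT), forall x, x \in U -> P x (h x).
Proof.
move=> Plin Pex.
have P0 : P 0 0.
  have [y Py] := Pex 0 (mem0v U).
  by have := Plin (-1) _ _ _ _ Py Py; rewrite !scaleN1r !addNr.
have /choice[z Pz] : forall i : 'I_(\dim U), exists y, P (vbasis U)`_i y.
  by move=> i; apply: Pex; apply: vbasis_mem; rewrite mem_nth ?size_tuple.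
have [|h hE] := @ex_lfun k aT rT
  (fun x => \sum_i coord (vbasis U) i x *: z i).
  move=> c x y; rewrite scaler_sumr -big_split /=.
  by apply: eq_bigr => i _; rewrite linearP /= scalerDl scalerA.
exists h => x xU; rewrite hE {1}(coord_vbasis xU).
elim/big_rec2 : _ => // i y x' _ Pxy; exact: Plin.
Qed.

Section FfunVspace.

Variables (k : fieldType) (A : finType) (E : vectType k).
Implicit Types W : A -> {vspace E}.

Definition single_fun (a : A) (v : E) : {ffun A -> E} :=
  [ffun b => if b == a then v else 0].

Lemma single_fun_is_linear a : linear (single_fun a).
Proof.
move=> c u v; apply/ffunP => b; rewrite !ffunE.
by case: eqP; rewrite ?scaler0 ?addr0.
Qed.

HB.instance Definition _ a :=
  GRing.isLinear.Build k E {ffun A -> E} _ (single_fun a)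
    (single_fun_is_linear a).

Definition proj_fun (a : A) (x : {ffun A -> E}) : E := x a.

Lemma proj_fun_is_linear a : linear (proj_fun a).
Proof. by move=> c u v; rewrite /proj_fun !ffunE. Qed.

HB.instance Definition _ a :=
  GRing.isLinear.Build k {ffun A -> E} E _ (proj_fun a)
    (proj_fun_is_linear a).

(** An external direct sum of the [W a], placed inside one vector space. It serves both for the
    spaces around a sink, indexed by arrows, and for the Hom spaces counted by the Euler form. *)
Definition ffunv W : {vspace {ffun A -> E}} :=
  (\sum_a linfun (single_fun a) @: W a)%VS.

Lemma ffun_sum_single (x : {ffun A -> E}) : x = \sum_a single_fun a (x a).
Proof.
apply/ffunP => b; rewrite sum_ffunE (bigD1 b) //= ffunE eqxx big1 ?addr0 //.
by move=> a /negPf; rewrite ffunE eq_sym => ->.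
Qed.

Lemma memv_ffunv W (x : {ffun A -> E}) :
  reflect (forall a, x a \in W a) (x \in ffunv W).
Proof.
apply: (iffP memv_sumP) => [[y yW ->] a | xW].
  rewrite sum_ffunE memv_suml // => b _.
  have /memv_imgP[v vW ->] := yW b isT; rewrite lfunE ffunE /=.
  by case: eqP => [->|] //; rewrite mem0v.
exists (fun a => single_fun a (x a)); last exact: ffun_sum_single.
by move=> a _; apply/memv_imgP; exists (x a); rewrite ?lfunE.
Qed.

Lemma dim_ffunv W : \dim (ffunv W) = (\sum_a \dim (W a))%N.
Proof.
have /directvP -> /= : directv (\sum_a linfun (single_fun a) @: W a).
  apply/directv_sum_independent => y yW y0 a _.
  have E0 b : y b = single_fun b (y b b).
    have /memv_imgP[v vW ->] := yW b isT; rewrite lfunE.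
    by congr single_fun; rewrite ffunE eqxx.
  have : (\sum_b y b) a = 0 by rewrite y0 ffunE.
  rewrite sum_ffunE (bigD1 a) //= big1 ?addr0 => [ya0 | b /negPf ba].
    by rewrite E0 ya0 linear0.
  by rewrite E0 ffunE eq_sym ba.
apply: eq_bigr => a _; rewrite limg_dim_eq //; apply/eqP; rewrite -subv0.
apply/subvP => v; rewrite memv_cap memv_ker lfunE /= memv0 => /andP[_].
by move/eqP/ffunP/(_ a); rewrite !ffunE eqxx => /eqP.
Qed.

End FfunVspace.

(** * Representations and reflections at a sink *)

Section EmbeddedReps.

Variables (k : fieldType) (I A : finType).

(* The spaces at all vertices lie in one ambient space: the orientation of the
   arrows can then change without transport between the dependent types
   [M (source a)]. *)
Record erep := Erep {
  amb : vectType k;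
  esp :> I -> {vspace amb};
  emap : A -> 'End(amb) }.

Section Orientation.

Variables src tgt : A -> I.

Definition estable (M : erep) : Prop :=
  forall a x, x \in M (src a) -> emap M a x \in M (tgt a).

Definition ehom (M N : erep) (g : I -> 'Hom(amb M, amb N)) : Prop :=
  (forall i x, x \in M i -> g i x \in N i) /\
  forall a x, x \in M (src a) ->
    g (tgt a) (emap M a x) = emap N a (g (src a) x).

(** Indecomposability is stated through idempotents so that it crosses a reflection by transferring
    endomorphisms alone, without reflecting direct sums. Equalities are tested on the [M i] only,
    since maps are arbitrary elsewhere in the ambient space. *)
Definition eindec (M : erep) : Prop :=
  (exists i, M i <> 0%VS) /\
  forall e, ehom (M := M) (N := M) e ->
    (forall i x, x \in M i -> e i (e i x) = e i x) ->
    (forall i x, x \in M i -> e i x = 0) \/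
    (forall i x, x \in M i -> e i x = x).

End Orientation.

Section Reflection.

Variables (src tgt : A -> I) (u : I).

(** Every arrow at [u] is reversed, also those leaving [u], which [esink] allows. *)
Definition flip_src (a : A) : I :=
  if (src a == u) || (tgt a == u) then tgt a else src a.
Definition flip_tgt (a : A) : I :=
  if (src a == u) || (tgt a == u) then src a else tgt a.

(** A sink relative to the support of [M]: arrows leaving [u] are tolerated when they lead to
    another vertex where [M] vanishes. *)
Definition esink (M : erep) : Prop :=
  forall a, src a = u -> tgt a != u /\ M (tgt a) = 0%VS.

(* [M'] is the reflection of [M] at the sink [u]:
   0 -> M'_u -> (+)_(a : tgt a = u) M_(src a) -> M_u -> 0 is exact, [phi] and
   [psi] identifying the spaces at the other vertices. *)
Record reflects (M M' : erep) (phi : 'Hom(amb M, amb M'))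
    (psi : 'Hom(amb M', amb M)) : Prop := Reflects {
  refl_stable : estable src tgt M;
  refl_stable' : estable flip_src flip_tgt M';
  refl_sink : esink M;
  refl_sink' : esink M';
  refl_phi : forall j x, j != u -> x \in M j -> phi x \in M' j;
  refl_psi : forall j x, j != u -> x \in M' j -> psi x \in M j;
  refl_phiK : forall j x, j != u -> x \in M j -> psi (phi x) = x;
  refl_psiK : forall j x, j != u -> x \in M' j -> phi (psi x) = x;
  refl_map : forall a x, src a != u -> tgt a != u -> x \in M (src a) ->
    emap M' a (phi x) = phi (emap M a x);
  refl_inj : forall y, y \in M' u ->
    (forall a, tgt a = u -> emap M' a y = 0) -> y = 0;
  refl_surj : forall z, z \in M u ->
    exists2 x : A -> amb M, (forall a, tgt a = u -> x a \in M (src a)) &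
      \sum_(a | tgt a == u) emap M a (x a) = z;
  refl_exact : forall x : A -> amb M,
    (forall a, tgt a = u -> x a \in M (src a)) ->
    (\sum_(a | tgt a == u) emap M a (x a) = 0 <->
     exists2 y, y \in M' u & forall a, tgt a = u -> emap M' a y = phi (x a)) }.

Lemma sink_srcN M a : esink M -> tgt a = u -> src a != u.
Proof. by move=> sM ta; apply/eqP => /sM[/eqP]; rewrite ta. Qed.

Lemma stable_flip_in M a y : esink M -> estable flip_src flip_tgt M ->
  tgt a = u -> y \in M u -> emap M a y \in M (src a).
Proof.
by move=> sM stM ta; have := stM a y; rewrite /flip_src /flip_tgt ta eqxx orbT.
Qed.

Section Transfer.

Variables (M M' N N' : erep).
Variables (phiM : 'Hom(amb M, amb M')) (psiM : 'Hom(amb M', amb M)).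
Variables (phiN : 'Hom(amb N, amb N')) (psiN : 'Hom(amb N', amb N)).
Hypotheses (rM : reflects phiM psiM) (rN : reflects phiN psiN).

(** Functoriality of kernels: [g] carries the family of values of [y] along the arrows at [u] to a
    family with sum zero in [N], and exactness lifts it to [N' u]. Away from [u] the map is only
    transported by [psiM] and [phiN]. *)
Lemma ehom_reflect g : ehom src tgt g -> exists2 g',
  ehom flip_src flip_tgt (M := M') (N := N') g' &
  forall j, j != u -> g' j = (phiN \o g j \o psiM)%VF.
Proof.
move=> [gM gmap].
have [||h hP] := @linear_choice k (amb M') (amb N') (M' u)
    (fun y z => z \in N' u /\ forall a, tgt a = u ->
       emap N' a z = phiN (g (src a) (psiM (emap M' a y)))).
- move=> c y1 z1 y2 z2 [z1N e1] [z2N e2]; split; first by rewrite memvD ?memvZ.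
  by move=> a ta; rewrite !linearP /= e1 // e2.
- move=> y yM.
  have xM a : tgt a = u -> psiM (emap M' a y) \in M (src a).
    move=> ta; have sa := sink_srcN (refl_sink rM) ta.
    apply: (refl_psi rM) => //.
    exact: stable_flip_in (refl_sink' rM) (refl_stable' rM) ta yM.
  have /(refl_exact rM xM) sum0 : exists2 z, z \in M' u &
      forall a, tgt a = u -> emap M' a z = phiM (psiM (emap M' a y)).
    exists y => // a ta; have sa := sink_srcN (refl_sink rM) ta.
    rewrite (refl_psiK rM sa) //.
    exact: stable_flip_in (refl_sink' rM) (refl_stable' rM) ta yM.
  have gxN a : tgt a = u -> g (src a) (psiM (emap M' a y)) \in N (src a).
    by move=> /xM/gM.
  have /(refl_exact rN gxN)[z zN ze] :
      \sum_(a | tgt a == u) emap N a (g (src a) (psiM (emap M' a y))) = 0.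
    rewrite -[RHS](linear0 (g u)) -sum0 linear_sum /=.
    by apply: eq_bigr => a /eqP ta; rewrite -gmap ?xM // ta.
  by exists z.
exists (fun j => if j == u then h else (phiN \o g j \o psiM)%VF); last first.
  by move=> j /negPf ->.
split=> [i x xM|a x].
  case: eqP xM => [-> /hP[]//|/eqP iu xM].
  by rewrite !comp_lfunE (refl_phi rN) ?gM ?(refl_psi rM).
rewrite /flip_src /flip_tgt; case: (eqVneq (src a) u) => [sa|sa] /=.
  have [/negPf tu M0] := refl_sink' rM sa.
  by rewrite M0 memv0 => /eqP ->; rewrite !linear0.
case: eqP => [ta|/eqP ta] xM.
  rewrite ta eqxx (negPf sa).
  by rewrite !comp_lfunE (hP x _).2 // -ta.
rewrite (negPf ta) (negPf sa) !comp_lfunE.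
set x0 := psiM x; have x0M : x0 \in M (src a) by apply: (refl_psi rM).
rewrite -(refl_psiK rM sa xM) -/x0 (refl_map rM) //.
rewrite (refl_phiK rM ta) ?(refl_stable rM) //.
by rewrite (refl_map rN) ?gM // gmap.
Qed.

(** Functoriality of cokernels: a vector of [M u] is the sum of the images of some family, and its
    image is computed from that family. The fact [v0] says that families with sum zero cause no
    ambiguity. *)
Lemma ehom_unreflect g' : ehom flip_src flip_tgt g' -> exists2 g,
  ehom src tgt (M := M) (N := N) g &
  forall j, j != u -> g j = (psiN \o g' j \o phiM)%VF.
Proof.
move=> [gM gmap].
pose v a x := emap N a (psiN (g' (src a) (phiM x))).
have lv a c x y : v a (c *: x + y) = c *: v a x + v a y.
  by rewrite /v !linearP.
have vxN a x : tgt a = u -> x \in M (src a) ->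
    psiN (g' (src a) (phiM x)) \in N (src a).
  move=> ta xM; have sa := sink_srcN (refl_sink rM) ta.
  by apply: (refl_psi rN) => //; apply: gM; apply: (refl_phi rM).
have v0 x : (forall a, tgt a = u -> x a \in M (src a)) ->
    \sum_(a | tgt a == u) emap M a (x a) = 0 ->
    \sum_(a | tgt a == u) v a (x a) = 0.
  move=> xM /(refl_exact rM xM)[y yM ye].
  apply/(refl_exact rN (x := fun a => psiN (g' (src a) (phiM (x a))))).
    by move=> a ta; apply: vxN => //; apply: xM.
  exists (g' u y) => [|a ta]; first exact: gM.
  have sa := sink_srcN (refl_sink rM) ta.
  have := gmap a y; rewrite /flip_src /flip_tgt ta eqxx orbT => <- //.
  rewrite ye // (refl_psiK rN sa) //; apply: gM; apply: (refl_phi rM) => //.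
  exact: xM.
have [||h hP] := @linear_choice k (amb M) (amb N) (M u)
    (fun z z' => exists2 x : A -> amb M,
       (forall a, tgt a = u -> x a \in M (src a)) &
       \sum_(a | tgt a == u) emap M a (x a) = z /\
       z' = \sum_(a | tgt a == u) v a (x a)).
- move=> c z1 w1 z2 w2 [x1 x1M [<- ->]] [x2 x2M [<- ->]].
  exists (fun a => c *: x1 a + x2 a).
    by move=> a ta; rewrite memvD ?memvZ ?x1M ?x2M.
  split; rewrite scaler_sumr -big_split /=; apply: eq_bigr => a _.
    by rewrite linearP.
  by rewrite lv.
- move=> z /(refl_surj rM)[x xM xz].
  by exists (\sum_(a | tgt a == u) v a (x a)), x.
have hN z : z \in M u -> h z \in N u.
  move=> /hP[x xM [_ ->]]; rewrite memv_suml // => a /eqP ta.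
  by rewrite -ta; apply: (refl_stable rN); apply: vxN => //; apply: xM.
exists (fun j => if j == u then h else (psiN \o g' j \o phiM)%VF); last first.
  by move=> j /negPf ->.
split=> [i x xM|a x xM].
  case: eqP xM => [-> /hN//|/eqP iu xM].
  by rewrite !comp_lfunE (refl_psi rN) ?gM ?(refl_phi rM).
case: (eqVneq (src a) u) => [sa|sa] /=.
  have [/negPf tu M0] := refl_sink rM sa; have [_ N0] := refl_sink rN sa.
  have := refl_stable rM xM; rewrite M0 memv0 => /eqP ->.
  rewrite sa in xM; have := refl_stable rN (a := a) (x := h x).
  by rewrite sa => /(_ (hN _ xM)); rewrite N0 memv0 => /eqP ->; rewrite linear0.
case: eqP => [ta|/eqP ta].
  have fxM : emap M a x \in M u by rewrite -ta (refl_stable rM).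
  have [x0 x0M [x0e ->]] := hP _ fxM.
  (* The value of [h] was computed from some family [x0] with the same sum as the family equal to
     [x] at [a] and zero elsewhere. Their difference [x0 + x1] has sum zero, so [v0] applies. *)
  pose x1 b := if b == a then - x else 0.
  have sumx1 (F : A -> amb M -> amb N) : (forall b, F b 0 = 0) ->
      \sum_(b | tgt b == u) F b (x1 b) = F a (- x).
    move=> F0; rewrite (bigD1 a) ?ta //= /x1 eqxx big1 ?addr0 //.
    by move=> b /andP[_ /negPf ->].
  have lv0 b : v b 0 = 0 by rewrite /v !linear0.
  have vN b y : v b (- y) = - v b y by rewrite /v !linearN.
  apply/eqP; rewrite -subr_eq0 !comp_lfunE -/(v a x) -vN -(sumx1 v) //.
  rewrite -big_split /=; apply/eqP.
  apply: etrans (v0 (fun b => x0 b + x1 b) _ _).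
  - apply: eq_bigr => b _; have := lv b 1 (x0 b) (x1 b).
    by rewrite !scale1r.
  - move=> b tb; rewrite memvD ?x0M // /x1; case: eqP => [->|_].
      by rewrite memvN.
    exact: mem0v.
  - under eq_bigr do rewrite linearD; rewrite big_split /= x0e.
    rewrite (bigD1 a) ?ta //= /x1 eqxx big1 ?addr0 ?linearN ?subrr //.
    by move=> b /andP[_ /negPf ->]; rewrite linear0.
rewrite !comp_lfunE -(refl_map rM) //.
have := gmap a (phiM x); rewrite /flip_src /flip_tgt (negPf sa) (negPf ta) /=.
move=> -> //; last exact: (refl_phi rM).
set y := g' _ _; have yN : y \in N' (src a) by apply/gM/(refl_phi rM).
rewrite -[in LHS](refl_psiK rN sa yN) (refl_map rN) ?(refl_psi rN) //.
by rewrite (refl_phiK rN ta) // (refl_stable rN) ?(refl_psi rN).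
Qed.

End Transfer.

Section IndecTransfer.

Variables (M M' : erep).
Variables (phi : 'Hom(amb M, amb M')) (psi : 'Hom(amb M', amb M)).
Hypothesis rM : reflects phi psi.

(** By [refl_inj], [M' u] is cogenerated by its neighbours, so an endomorphism is determined by its
    components away from [u]. *)
Lemma reflect_hom_eq (g h : I -> 'End(amb M')) :
  ehom flip_src flip_tgt (M := M') (N := M') g ->
  ehom flip_src flip_tgt (M := M') (N := M') h ->
  (forall j x, j != u -> x \in M' j -> g j x = h j x) ->
  forall j x, x \in M' j -> g j x = h j x.
Proof.
move=> [gM gmap] [hM hmap] gh j x xM.
case: (eqVneq j u) xM => [-> xM|ju xM]; last exact: gh.
apply/eqP; rewrite -subr_eq0; apply/eqP/(refl_inj rM).
  by rewrite memvB ?gM ?hM.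
move=> a ta; have sa := sink_srcN (refl_sink rM) ta; rewrite linearB /=.
have := gmap a x; have := hmap a x; rewrite /flip_src /flip_tgt ta eqxx orbT.
move=> <- // <- //; rewrite gh ?subrr //.
exact: stable_flip_in (refl_sink' rM) (refl_stable' rM) ta xM.
Qed.

(** By [refl_surj], [M u] is generated by the images of its neighbours, so the components away from
    [u] again suffice. *)
Lemma unreflect_hom_eq (g h : I -> 'End(amb M)) :
  ehom src tgt (M := M) (N := M) g -> ehom src tgt (M := M) (N := M) h ->
  (forall j x, j != u -> x \in M j -> g j x = h j x) ->
  forall j x, x \in M j -> g j x = h j x.
Proof.
move=> [gM gmap] [hM hmap] gh j x xM.
case: (eqVneq j u) xM => [-> xM|ju xM]; last exact: gh.
have [y yM <-] := refl_surj rM xM; rewrite !linear_sum /=.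
apply: eq_bigr => a /eqP ta; have sa := sink_srcN (refl_sink rM) ta.
by rewrite -ta gmap ?hmap ?gh //; apply: yM.
Qed.

Lemma ehom0 s t (N : erep) : ehom s t (M := N) (N := N) (fun=> 0).
Proof. by split=> *; rewrite !zero_lfunE ?mem0v // linear0. Qed.

Lemma ehom1 s t (N : erep) : ehom s t (M := N) (N := N) (fun=> \1%VF).
Proof. by split=> *; rewrite !id_lfunE. Qed.

Lemma ehom_comp s t (M1 M2 M3 : erep)
    (g : I -> 'Hom(amb M2, amb M3)) (f : I -> 'Hom(amb M1, amb M2)) :
  ehom s t g -> ehom s t f -> ehom s t (fun i => (g i \o f i)%VF).
Proof.
move=> [gM gmap] [fM fmap].
split=> [i x xM|a x xM]; rewrite !comp_lfunE ?gM ?fM //.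
by rewrite fmap // gmap // fM.
Qed.

(** An idempotent of [M'] is transferred to [M], found to be 0 or 1 there, and compared with [e]
    away from [u]. Surjectivity at [u] prevents [M] from living at [u] alone, whence [M'] is
    nonzero. *)
Lemma eindec_reflect : eindec src tgt M -> eindec flip_src flip_tgt M'.
Proof.
move=> [[i0 Mi0] indM]; split.
  suff [j ju [x xM x0]] : exists2 j, j != u & exists2 x, x \in M j & x != 0.
    exists j => M'j; have := refl_phi rM ju xM.
    rewrite M'j memv0 => /eqP p0; case/eqP: x0.
    by rewrite -(refl_phiK rM ju xM) p0 linear0.
  have pick0 : vpick (M i0) != 0 by rewrite vpick0; apply/eqP.
  case: (eqVneq i0 u) => [i0u|i0u]; last first.
    by exists i0 => //; exists (vpick (M i0)); rewrite ?memv_pick.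
  have : vpick (M i0) \in M u by rewrite -i0u memv_pick.
  case/(refl_surj rM) => x xM xE.
  case: (pselect (exists2 a, tgt a = u & x a != 0)) => [[a ta xa]|nx].
    exists (src a); first exact: sink_srcN (refl_sink rM) ta.
    by exists (x a) => //; apply: xM.
  case/eqP: pick0; rewrite -xE big1 // => a /eqP ta.
  have [->|xa] := eqVneq (x a) 0; first by rewrite linear0.
  by case: nx; exists a.
move=> e eh eK; have [g gh gE] := ehom_unreflect rM rM eh.
have gK : forall i x, x \in M i -> g i (g i x) = g i x.
  move=> i x xM; rewrite -comp_lfunE.
  apply: (unreflect_hom_eq (ehom_comp gh gh) gh _ xM) => j y ju yM.
  rewrite !gE // !comp_lfunE.
  have py := refl_phi rM ju yM.
  by rewrite (refl_psiK rM ju) ?eh.1 // eK.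
case: (indM g gh gK) => gi; [left|right].
  move=> i x xM; rewrite -[RHS](zero_lfunE _ x).
  apply: (reflect_hom_eq eh (@ehom0 _ _ _) _ xM) => j y ju yM.
  have := gi j (psi y) (refl_psi rM ju yM).
  rewrite gE // !comp_lfunE (refl_psiK rM ju yM) zero_lfunE => p0.
  by rewrite -(refl_psiK rM ju (eh.1 _ _ yM)) p0 linear0.
move=> i x xM; rewrite -[RHS]id_lfunE.
apply: (reflect_hom_eq eh (@ehom1 _ _ _) _ xM) => j y ju yM.
have := gi j (psi y) (refl_psi rM ju yM).
rewrite gE // !comp_lfunE (refl_psiK rM ju yM) id_lfunE => p0.
by rewrite -(refl_psiK rM ju (eh.1 _ _ yM)) p0 (refl_psiK rM ju yM).
Qed.

Lemma eindec_unreflect : eindec flip_src flip_tgt M' -> eindec src tgt M.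
Proof.
move=> [[i0 Mi0] indM]; split.
  suff [j ju [x xM x0]] : exists2 j, j != u & exists2 x, x \in M' j & x != 0.
    exists j => Mj; have := refl_psi rM ju xM.
    rewrite Mj memv0 => /eqP p0; case/eqP: x0.
    by rewrite -(refl_psiK rM ju xM) p0 linear0.
  have pick0 : vpick (M' i0) != 0 by rewrite vpick0; apply/eqP.
  case: (eqVneq i0 u) => [i0u|i0u]; last first.
    by exists i0 => //; exists (vpick (M' i0)); rewrite ?memv_pick.
  have yM : vpick (M' i0) \in M' u by rewrite -i0u memv_pick.
  case: (pselect (exists2 a, tgt a = u & emap M' a (vpick (M' i0)) != 0)).
    move=> [a ta xa].
    exists (src a); first exact: sink_srcN (refl_sink rM) ta.
    exists (emap M' a (vpick (M' i0))) => //.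
    exact: stable_flip_in (refl_sink' rM) (refl_stable' rM) ta yM.
  move=> nx; case/eqP: pick0; apply: (refl_inj rM) => // a ta.
  by apply/eqP/negP => /negP xa; case: nx; exists a.
move=> e eh eK; have [g gh gE] := ehom_reflect rM rM eh.
have gK : forall i x, x \in M' i -> g i (g i x) = g i x.
  move=> i x xM; rewrite -comp_lfunE.
  apply: (reflect_hom_eq (ehom_comp gh gh) gh _ xM) => j y ju yM.
  rewrite !gE // !comp_lfunE.
  have py := refl_psi rM ju yM.
  by rewrite (refl_phiK rM ju) ?eh.1 // eK.
case: (indM g gh gK) => gi; [left|right].
  move=> i x xM; rewrite -[RHS](zero_lfunE _ x).
  apply: (unreflect_hom_eq eh (@ehom0 _ _ _) _ xM) => j y ju yM.
  have := gi j (phi y) (refl_phi rM ju yM).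
  rewrite gE // !comp_lfunE (refl_phiK rM ju yM) zero_lfunE => p0.
  by rewrite -(refl_phiK rM ju (eh.1 _ _ yM)) p0 linear0.
move=> i x xM; rewrite -[RHS]id_lfunE.
apply: (unreflect_hom_eq eh (@ehom1 _ _ _) _ xM) => j y ju yM.
have := gi j (phi y) (refl_phi rM ju yM).
rewrite gE // !comp_lfunE (refl_phiK rM ju yM) id_lfunE => p0.
by rewrite -(refl_phiK rM ju (eh.1 _ _ yM)) p0 (refl_phiK rM ju yM).
Qed.

End IndecTransfer.

End Reflection.

End EmbeddedReps.

(** * Existence of reflections and their effect on dimensions *)

Section ReflectionExists.

Variables (k : fieldType) (I A : finType) (src tgt : A -> I) (u : I).
Implicit Types M : erep k I A.

Definition in_space M : {vspace {ffun A -> amb M}} :=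
  ffunv (fun a => if tgt a == u then M (src a) else 0%VS).

Lemma in_spaceP M (x : {ffun A -> amb M}) :
  reflect ((forall a, tgt a = u -> x a \in M (src a)) /\
           (forall a, tgt a <> u -> x a = 0)) (x \in in_space M).
Proof.
apply: (iffP (memv_ffunv _ _)) => [xP|[xM x0] a].
  split=> a ta; have := xP a; first by rewrite ta eqxx.
  by case: eqP => // _; rewrite memv0 => /eqP.
by case: eqP => [/xM//|/x0->]; rewrite mem0v.
Qed.

Lemma ex_in_map M : {p : 'Hom({ffun A -> amb M}, amb M) |
  forall x, p x = \sum_(a | tgt a == u) emap M a (x a)}.
Proof.
apply: ex_lfun => c x y; rewrite scaler_sumr -big_split /=.
by apply: eq_bigr => a _; rewrite !ffunE linearP.
Qed.

Lemma ex_out_map M : {q : 'Hom(amb M, {ffun A -> amb M}) |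
  forall y, q y = [ffun a => if tgt a == u then emap M a y else 0]}.
Proof.
apply: ex_lfun => c x y; apply/ffunP => a; rewrite !ffunE.
by case: eqP => _; rewrite ?linearP // scaler0 addr0.
Qed.

(** The new ambient space is [amb M * F]: the first factor carries the old spaces, the second the
    kernel [K] of the sum of the incoming maps. A reversed arrow at [u] reads off one component of a
    family in [K]. *)
Lemma ex_reflect_sink M : estable src tgt M -> esink src tgt u M ->
  (forall z, z \in M u -> exists2 x : A -> amb M,
     (forall a, tgt a = u -> x a \in M (src a)) &
     \sum_(a | tgt a == u) emap M a (x a) = z) ->
  exists (M' : erep k I A) (phi : 'Hom(amb M, amb M'))
    (psi : 'Hom(amb M', amb M)), reflects src tgt u phi psi.
Proof.
move=> stM sM surjM; have [p pE] := ex_in_map M.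
pose F := {ffun A -> amb M}; pose K : {vspace F} := (in_space M :&: lker p)%VS.
pose E := (amb M * F)%type.
have [|il ilE] := @ex_lfun k (amb M) E (fun v => (v, 0)).
  by move=> c x y; congr pair => /=; rewrite scaler0 addr0.
have [|ir irE] := @ex_lfun k F E (fun v => (0, v)).
  by move=> c x y; congr pair => /=; rewrite scaler0 addr0.
have [//|pl plE] := @ex_lfun k E (amb M) fst.
have /choice[f' f'E] : forall a, exists g : 'End(E), forall w,
    g w = if tgt a == u then (w.2 a, 0) else (emap M a w.1, 0).
  move=> a; have [|g gE] := @ex_lfun k E E
    (fun w => if tgt a == u then (w.2 a, 0) else (emap M a w.1, 0)).
    move=> c x y; case: ifP => _; congr pair => /=.
    - by rewrite !ffunE.
    - by rewrite scaler0 addr0.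
    - by rewrite linearP.
    - by rewrite scaler0 addr0.
  by exists g.
pose M' := @Erep k I A E
  (fun j => if j == u then (ir @: K)%VS else (il @: M j)%VS) f'.
have KP y : y \in M' u -> exists2 x, x \in K & y = (0, x).
  by rewrite /= eqxx => /memv_imgP[x xK ->]; exists x.
have MP j y : j != u -> y \in M' j -> exists2 x, x \in M j & y = (x, 0).
  by move=> /negPf /= -> /memv_imgP[x xK ->]; exists x.
have inM j x : j != u -> x \in M j -> il x \in M' j.
  by move=> /negPf /= -> ; apply: memv_img.
have sM' : esink src tgt u M'.
  move=> a /sM[tu M0]; split => //.
  by rewrite /= (negPf tu) M0 limg0.
exists M', il, pl; split=> //.
- move=> a y; rewrite /flip_src /flip_tgt.
  have [sa|sa] := eqVneq (src a) u.
    have [_ M0] := sM' a sa.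
    by rewrite M0 memv0 => /eqP ->; rewrite linear0 mem0v.
  have [ta|ta] := eqVneq (tgt a) u => /=.
    rewrite ta => /KP[x /memv_capP[/in_spaceP[xM _] _] ->].
    by rewrite f'E ta eqxx /= -ilE inM ?xM.
  move=> /(MP _ _ sa)[x xM ->].
  by rewrite f'E (negPf ta) /= -ilE; rewrite memv_img ?stM.
- by move=> j x ju /(MP _ _ ju)[y yM ->]; rewrite plE.
- by move=> j x ju xM; rewrite ilE plE.
- by move=> j x ju /(MP _ _ ju)[y yM ->]; rewrite plE ilE.
- by move=> a x sa ta xM; rewrite f'E (negPf ta) !ilE.
- move=> y /KP[x /memv_capP[/in_spaceP[xM x0] _] ->] fx.
  congr pair; apply/ffunP => a; rewrite ffunE.
  have [ta|/eqP/x0 //] := eqVneq (tgt a) u.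
  by have := fx a ta; rewrite f'E ta eqxx /= => -[].
move=> x xM; split=> [x0|[y0 /KP[z /memv_capP[/in_spaceP[zM z0]]]]].
  exists (0, [ffun a => if tgt a == u then x a else 0]).
    rewrite /= eqxx -irE memv_img // memv_cap memv_ker pE; apply/andP; split.
      by apply/in_spaceP; split=> a; rewrite ffunE; case: eqP => // ta; rewrite xM.
    by apply/eqP; rewrite -[RHS]x0; apply: eq_bigr => a ta; rewrite ffunE ta.
  by move=> a ta; rewrite f'E ta eqxx ilE /= ffunE ta eqxx.
rewrite memv_ker pE => /eqP pz -> fz; rewrite -[RHS]pz.
apply: eq_bigr => a /eqP ta; have := fz a ta.
by rewrite f'E ta eqxx ilE => -[] ->.
Qed.

(** Dually, [M u] must be the cokernel of the map from [M' u] to the sum of its neighbours. The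
    endomorphism [pr] has kernel exactly the image [K] of [M' u], so its own image of [in_space M']
    is a model of this cokernel inside [F]. *)
Lemma ex_reflect_source M' :
  estable (flip_src src tgt u) (flip_tgt src tgt u) M' -> esink src tgt u M' ->
  (forall y, y \in M' u ->
    (forall a, tgt a = u -> emap M' a y = 0) -> y = 0) ->
  exists (M : erep k I A) (phi : 'Hom(amb M, amb M'))
    (psi : 'Hom(amb M', amb M)), reflects src tgt u phi psi.
Proof.
move=> stM sM injM; have [q qE] := ex_out_map M'.
pose F := {ffun A -> amb M'}; pose K : {vspace F} := (q @: M' u)%VS.
pose E := (amb M' * F)%type.
pose pr : 'End(F) := (\1 - projv K)%VF.
have prE x : pr x = x - projv K x by rewrite add_lfunE opp_lfunE id_lfunE.
have pr0 x : (pr x == 0) = (x \in K).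
  rewrite prE subr_eq0; apply/eqP/idP => [->|/projv_id-> //].
  exact: memv_proj.
have [|il ilE] := @ex_lfun k (amb M') E (fun v => (v, 0)).
  by move=> c x y; congr pair => /=; rewrite scaler0 addr0.
have [|ir irE] := @ex_lfun k F E (fun v => (0, v)).
  by move=> c x y; congr pair => /=; rewrite scaler0 addr0.
have [//|pl plE] := @ex_lfun k E (amb M') fst.
have /choice[f fE] : forall a, exists g : 'End(E), forall w,
    g w = if tgt a == u then (0, pr (single_fun a w.1)) else (emap M' a w.1, 0).
  move=> a; have [|g gE] := @ex_lfun k E E (fun w =>
    if tgt a == u then (0, pr (single_fun a w.1)) else (emap M' a w.1, 0)).
    move=> c x y; case: ifP => _; congr pair => /=.
    - by rewrite scaler0 addr0.
    - by rewrite !linearP.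
    - by rewrite linearP.
    - by rewrite scaler0 addr0.
  by exists g.
pose M := @Erep k I A E (fun j =>
  if j == u then (ir @: (pr @: in_space M'))%VS else (il @: M' j)%VS) f.
have MP j y : j != u -> y \in M j -> exists2 x, x \in M' j & y = (x, 0).
  by move=> /negPf /= -> /memv_imgP[x xK ->]; exists x.
have inM j x : j != u -> x \in M' j -> il x \in M j.
  by move=> /negPf /= -> ; apply: memv_img.
have sM' : esink src tgt u M.
  move=> a /sM[tu M0]; split => //.
  by rewrite /= (negPf tu) M0 limg0.
have sumE (x : A -> E) : \sum_(a | tgt a == u) emap M a (x a) =
    (0, pr [ffun a => if tgt a == u then (x a).1 else 0]).
  rewrite (ffun_sum_single [ffun _ => _]) linear_sum /= -irE linear_sum /=.
  rewrite big_mkcond /=; apply: eq_bigr => a _; rewrite ffunE irE fE.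
  by case: ifP => ta; rewrite ?ta /= ?linear0.
exists M, pl, il; split=> //.
- move=> a y; have [sa|sa] := eqVneq (src a) u.
    have [tu M0] := sM a sa; rewrite sa /= eqxx => /memv_imgP[x _ ->].
    by rewrite irE fE (negPf tu) /= linear0 mem0v.
  move=> /(MP _ _ sa)[x xM ->]; rewrite fE.
  have [ta|ta] := eqVneq (tgt a) u.
    rewrite ta /= eqxx -irE !memv_img //.
    apply/in_spaceP; split=> b tb; rewrite ffunE.
      by case: eqP => [->//|_]; rewrite mem0v.
    by case: eqP => // ba; rewrite ba in tb.
  rewrite /= (negPf ta) -ilE memv_img //.
  by have := stM a x; rewrite /flip_src /flip_tgt (negPf sa) (negPf ta); apply.
- by move=> j x ju /(MP _ _ ju)[y yM ->]; rewrite plE.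
- by move=> j x ju /(MP _ _ ju)[y yM ->]; rewrite plE ilE.
- by move=> j x ju xM; rewrite ilE plE.
- move=> a x sa ta /(MP _ _ sa)[y yM ->].
  by rewrite !plE fE (negPf ta).
- move=> z; rewrite /= eqxx => /memv_imgP[_ /memv_imgP[x /in_spaceP[xM x0] ->] ->].
  exists (fun a => il (x a)) => [a ta|].
    by apply: inM; [exact: sink_srcN sM ta|exact: xM].
  rewrite (sumE (fun a => il (x a))) irE; congr (_, pr _); apply/ffunP => a.
  by rewrite ffunE; case: eqP => [_|/x0 //]; rewrite ilE.
move=> x xM; have {xM}xM a : tgt a = u -> exists2 z, z \in M' (src a) & x a = (z, 0).
  by move=> ta; apply: MP (xM _ ta); apply: sink_srcN sM ta.
rewrite sumE; split=> [[] /eqP|[y yM yE]].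
  rewrite pr0 => /memv_imgP[y yM /ffunP yE]; exists y => // a ta.
  by have := yE a; rewrite qE !ffunE ta eqxx plE => ->.
congr pair; apply/eqP; rewrite pr0; apply/memv_imgP; exists y => //.
by apply/ffunP => a; rewrite qE !ffunE; case: eqP => // /yE->; rewrite plE.
Qed.

Section Dimensions.

Variables (M M' : erep k I A).
Variables (phi : 'Hom(amb M, amb M')) (psi : 'Hom(amb M', amb M)).
Hypothesis rM : reflects src tgt u phi psi.

Lemma dim_reflect_other j : j != u -> \dim (M' j) = \dim (M j).
Proof.
move=> ju; have -> : M' j = (phi @: M j)%VS.
  apply/vspaceP => y; apply/idP/memv_imgP => [yM|[x xM ->]].
    exists (psi y); first exact: refl_psi rM _ _ ju yM.
    by rewrite (refl_psiK rM ju yM).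
  exact: refl_phi rM _ _ ju xM.
apply: limg_dim_eq; apply/eqP; rewrite -subv0; apply/subvP => x.
rewrite memv_cap memv_ker memv0 => /andP[xM /eqP x0].
by rewrite -(refl_phiK rM ju xM) x0 linear0.
Qed.

(** Rank-nullity for the sum of the incoming maps: its image is [M u], and its kernel is a copy of
    [M' u] by exactness. *)
Lemma dim_reflect_at :
  (\dim (M' u) + \dim (M u))%N = (\sum_(a | tgt a == u) \dim (M (src a)))%N.
Proof.
have [p pE] := ex_in_map M.
have [|q qE] := @ex_lfun k (amb M') {ffun A -> amb M}
    (fun y => [ffun a => if tgt a == u then psi (emap M' a y) else 0]).
  move=> c x y; apply/ffunP => a; rewrite !ffunE.
  by case: eqP => _; rewrite ?linearP // scaler0 addr0.
have sumP : \dim (in_space M) = (\sum_(a | tgt a == u) \dim (M (src a)))%N.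
  rewrite dim_ffunv [RHS]big_mkcond /=; apply: eq_bigr => a _.
  by case: ifP; rewrite ?dimv0.
have sN a := @sink_srcN k I A src tgt u M a (refl_sink rM).
have fM' a y : tgt a = u -> y \in M' u -> emap M' a y \in M' (src a).
  by move=> ta; apply: stable_flip_in (refl_sink' rM) (refl_stable' rM) ta.
have imp : (p @: in_space M)%VS = M u.
  apply/vspaceP => z; apply/memv_imgP/idP => [[x /in_spaceP[xM _] ->]|].
    rewrite pE memv_suml // => a /eqP ta; rewrite -ta.
    by apply: (refl_stable rM); apply: xM.
  case/(refl_surj rM) => x xM xz.
  exists [ffun a => if tgt a == u then x a else 0].
    by apply/in_spaceP; split=> a; rewrite ffunE; case: eqP => // ta; rewrite xM.
  by rewrite pE -xz; apply: eq_bigr => a ta; rewrite ffunE ta.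
have kerp : (in_space M :&: lker p)%VS = (q @: M' u)%VS.
  apply/vspaceP => x; rewrite memv_cap memv_ker pE.
  apply/andP/memv_imgP => [[/in_spaceP[xM x0] /eqP px]|[y yM ->]].
    have /(refl_exact rM xM)[y yM yE] := px.
    exists y => //; apply/ffunP => a; rewrite qE ffunE.
    case: eqP => [ta|/x0 //]; rewrite yE // (refl_phiK rM (sN a ta)) //.
    exact: xM.
  have qM a : tgt a = u -> q y a \in M (src a).
    move=> ta; rewrite qE ffunE ta eqxx.
    by apply: (refl_psi rM (sN a ta)); apply: fM'.
  split; first by apply/in_spaceP; split=> // a; rewrite qE ffunE; case: eqP.
  apply/eqP/(refl_exact rM qM); exists y => // a ta.
  by rewrite qE ffunE ta eqxx (refl_psiK rM (sN a ta)) // fM'.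
rewrite -sumP -(limg_ker_dim p (in_space M)) imp kerp limg_dim_eq //.
apply/eqP; rewrite -subv0; apply/subvP => y.
rewrite memv_cap memv_ker memv0 => /andP[yM /eqP/ffunP q0].
apply/eqP/(refl_inj rM) => // a ta; have := q0 a.
rewrite qE !ffunE ta eqxx => p0.
by rewrite -(refl_psiK rM (sN a ta) (fM' a y ta yM)) p0 linear0.
Qed.

End Dimensions.

(* Otherwise a complement in [M u] of the image of the incoming maps splits
   off. *)
Lemma eindec_sink_surj M : estable src tgt M -> esink src tgt u M ->
  eindec src tgt M -> (exists2 j, j != u & M j <> 0%VS) ->
  forall z, z \in M u -> exists2 x : A -> amb M,
     (forall a, tgt a = u -> x a \in M (src a)) &
     \sum_(a | tgt a == u) emap M a (x a) = z.
Proof.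
move=> stM sM [_ indM] [j ju Mj].
have [p pE] := ex_in_map M; pose W := (p @: in_space M)%VS.
have inW a x : tgt a = u -> x \in M (src a) -> emap M a x \in W.
  move=> ta xM; apply/memv_imgP; exists (single_fun a x).
    apply/in_spaceP; split=> b tb; rewrite ffunE.
      by case: eqP => [->//|_]; rewrite mem0v.
    by case: eqP => // ba; rewrite ba in tb.
  rewrite pE (bigD1 a) ?ta //= ffunE eqxx big1 ?addr0 // => b /andP[_ /negPf ba].
  by rewrite ffunE ba linear0.
have WM : (W <= M u)%VS.
  apply/subvP => _ /memv_imgP[x /in_spaceP[xM _] ->].
  rewrite pE memv_suml // => a /eqP ta; rewrite -ta.
  by apply: stM; apply: xM.
pose e i : 'End(amb M) := if i == u then projv W else \1%VF.
have eh : ehom src tgt (M := M) (N := M) e.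
  split=> [i x|a x xM]; rewrite /e.
    case: eqP => [-> _|_]; last by rewrite id_lfunE.
    by apply: (subvP WM); rewrite memv_proj.
  have [sa|sa] := eqVneq (src a) u.
    have [/negPf -> M0] := sM a sa; rewrite id_lfunE.
    have := stM a x xM; rewrite M0 memv0 => /eqP ->.
    have : projv W x \in M (src a).
      by rewrite sa (subvP WM) // memv_proj.
    by move=> /stM; rewrite M0 memv0 => /eqP ->.
  rewrite id_lfunE; case: eqP => [ta|_]; last by rewrite id_lfunE.
  by rewrite projv_id ?inW.
have eK i x : x \in M i -> e i (e i x) = e i x.
  by rewrite /e; case: eqP => _; rewrite ?projv_proj ?id_lfunE.
case: (indM e eh eK) => ei.
  case: Mj; apply/eqP; rewrite -subv0; apply/subvP => x xM.
  by have := ei j x xM; rewrite /e (negPf ju) id_lfunE => ->; rewrite mem0v.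
move=> z zM; have := ei u z zM; rewrite /e eqxx => zE.
have /memv_imgP[x /in_spaceP[xM _] xz] : z \in W by rewrite -zE memv_proj.
by exists (fun a => x a) => //; rewrite -pE.
Qed.

(** Dual to [eindec_sink_surj]: the common kernel [Z] of the reversed arrows at [u] splits off. The
    idempotent [e] with kernel [Z] is nonzero at [j], hence is the identity, and [Z] vanishes. *)
Lemma eindec_source_inj M :
  estable (flip_src src tgt u) (flip_tgt src tgt u) M -> esink src tgt u M ->
  eindec (flip_src src tgt u) (flip_tgt src tgt u) M ->
  (exists2 j, j != u & M j <> 0%VS) ->
  forall y, y \in M u -> (forall a, tgt a = u -> emap M a y = 0) -> y = 0.
Proof.
move=> stM sM [_ indM] [j ju Mj].
have [q qE] := ex_out_map M; pose Z := (M u :&: lker q)%VS.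
have ZP y : y \in Z -> forall a, tgt a = u -> emap M a y = 0.
  rewrite memv_cap memv_ker => /andP[_ /eqP/ffunP q0] a ta.
  by have := q0 a; rewrite qE !ffunE ta eqxx.
have ZM : (Z <= M u)%VS by apply: capvSl.
pose e i : 'End(amb M) := if i == u then (\1 - projv Z)%VF else \1%VF.
have euE x : e u x = x - projv Z x.
  by rewrite /e eqxx add_lfunE opp_lfunE id_lfunE.
have eE i x : i != u -> e i x = x by rewrite /e => /negPf ->; rewrite id_lfunE.
have eh : ehom (flip_src src tgt u) (flip_tgt src tgt u) (M := M) (N := M) e.
  split=> [i x|a x].
    have [->|iu] := eqVneq i u; last by rewrite eE.
    by move=> xM; rewrite euE memvB // (subvP ZM) ?memv_proj.
  rewrite /flip_src /flip_tgt.
  have [sa|sa] := eqVneq (src a) u.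
    have [_ M0] := sM a sa.
    by rewrite M0 memv0 => /eqP ->; rewrite !linear0.
  have [ta|ta] := eqVneq (tgt a) u => xM /=.
    rewrite eE // ta euE linearB /= (ZP (projv Z x)) ?memv_proj //.
    by rewrite subr0.
  by rewrite !eE.
have eK i x : x \in M i -> e i (e i x) = e i x.
  move=> _; have [->|iu] := eqVneq i u; last by rewrite !eE.
  by rewrite !euE linearB /= projv_proj subrr subr0.
case: (indM e eh eK) => ei.
  case: Mj; apply/eqP; rewrite -subv0; apply/subvP => x xM.
  by have := ei j x xM; rewrite eE // => ->; rewrite mem0v.
move=> y yM y0; have := ei u y yM; rewrite euE projv_id.
  by rewrite subrr.
rewrite memv_cap yM memv_ker qE; apply/eqP/ffunP => a; rewrite !ffunE.
by case: eqP => // /y0.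
Qed.

End ReflectionExists.

(** * Words in the simple reflections *)

Fixpoint admissible (I A : finType) (src tgt : A -> I) (s : seq I) : Prop :=
  if s is u :: s' then
    (forall a, src a = u -> tgt a \notin u :: s') /\
    admissible (flip_src src tgt u) (flip_tgt src tgt u) s'
  else True.

Section Reflections.

Variables (R : realType) (V : vectType R) (form : {dot V for idfun}).

Lemma dotC x y : form x y = form y x.
Proof. by rewrite (hermC form) expr0 mul1r. Qed.

Lemma reflE b x : refl form b x = x - (2 * form x b / form b b) *: b.
Proof. by rewrite lfunE. Qed.

Lemma form_gt0 b : b != 0 -> 0 < form b b.
Proof. exact: neq0_dnorm_gt0. Qed.

Lemma refl_self b : refl form b b = - b.
Proof.
have [->|b0] := eqVneq b 0; first by rewrite linear0 oppr0.
rewrite reflE mulfK ?lt0r_neq0 ?form_gt0 //.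
by rewrite scaler_nat mulr2n opprD addNKr.
Qed.

Lemma reflK b : involutive (refl form b).
Proof.
move=> x; rewrite [in X in refl _ _ X]reflE linearB linearZ /= refl_self reflE.
by rewrite scalerN opprK subrK.
Qed.

Lemma form_refl b x y : form (refl form b x) (refl form b y) = form x y.
Proof.
have [->|b0] := eqVneq b 0; first by rewrite !reflE !scaler0 !subr0.
have bb : form b b != 0 by rewrite lt0r_neq0 ?form_gt0.
rewrite !reflE linearBr linearBl linearBl !linearZr_LR !linearZl_LR /=.
by rewrite (dotC b y); field.
Qed.

End Reflections.

(** * Modules whose dimension vectors are the roots of an admissible word *)

Section WordRoots.

Variables (k : fieldType) (I A : finType).
Variables (R : realType) (V : vectType R) (form : {dot V for idfun}).
Variable alpha : I -> V.
Hypothesis alpha_free : forall c d : I -> R,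
  \sum_i c i *: alpha i = \sum_i d i *: alpha i -> c =1 d.
Implicit Types (M N : erep k I A) (src tgt : A -> I).

Definition edimvec M : V := \sum_i (\dim (M i))%:R *: alpha i.

Definition nonneg_vec (b : V) : Prop :=
  exists c : I -> nat, b = \sum_i (c i)%:R *: alpha i.

(** For a word u_1 ... u_n these are the roots s_(u_1) ... s_(u_(i-1)) alpha_(u_i); when the word is
    reduced they are the inversions of its product, see [word_roots_inversion]. *)
Fixpoint word_roots (s : seq I) : seq V :=
  if s is u :: s' then
    alpha u :: [seq refl form (alpha u) b | b <- word_roots s'] else [::].

(** The consequence of reducedness used for modules, stated for every suffix and without reference
    to a root system; see [reduced_nonneg_word]. *)
Fixpoint nonneg_word (s : seq I) : Prop :=
  if s is u :: s' then
    (forall b, b \in word_roots s -> nonneg_vec b) /\ nonneg_word s'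
  else True.

(** The simple reflection read off the arrows: the coordinate at [u] becomes the sum over its
    neighbours minus itself. Both ends of each arrow are counted, so the condition survives a change
    of orientation ([refl_along_flip]). *)
Definition refl_along src tgt : Prop := forall u (d : I -> R),
  refl form (alpha u) (\sum_i d i *: alpha i) =
  \sum_i d i *: alpha i +
  (\sum_a ((tgt a == u)%:R * d (src a) + (src a == u)%:R * d (tgt a))
    - 2 * d u) *: alpha u.

Lemma refl_along_flip src tgt u : refl_along src tgt ->
  refl_along (flip_src src tgt u) (flip_tgt src tgt u).
Proof.
move=> H v d; rewrite H; congr (_ + (_ - _) *: _); apply: eq_bigr => a _.
by rewrite /flip_src /flip_tgt; case: ifP => _ //; rewrite addrC.
Qed.

Lemma sum_alpha1 u (c : R) : \sum_i (if i == u then c else 0) *: alpha i = c *: alpha u.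
Proof.
rewrite (bigD1 u) //= eqxx big1 ?addr0 // => i /negPf ->.
by rewrite scale0r.
Qed.

Lemma word_roots_supp src tgt s b : refl_along src tgt -> b \in word_roots s ->
  exists2 d : I -> R, b = \sum_i d i *: alpha i &
    forall i, i \notin s -> d i = 0.
Proof.
move=> H; elim: s b => [//|u s IHs] b; rewrite inE => /predU1P[->|].
  exists (fun i => if i == u then 1 else 0).
    by rewrite sum_alpha1 scale1r.
  by move=> i; rewrite inE; case: eqP.
case/mapP=> b' /IHs[d -> d0] ->; rewrite H.
set c := _ - _; exists (fun i => d i + if i == u then c else 0).
  rewrite -sum_alpha1 -big_split /=; apply: eq_bigr => i _.
  by rewrite -scalerDl.
by move=> i; rewrite inE => /norP[/negPf-> /d0->]; rewrite addr0.
Qed.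

Lemma edimvec_supp src tgt s M i : refl_along src tgt ->
  edimvec M \in word_roots s -> i \notin s -> M i = 0%VS.
Proof.
move=> H /(word_roots_supp H)[d /alpha_free/(_ i) di d0] /d0.
rewrite -di => /eqP; rewrite (eqr_nat _ _ 0) dimv_eq0.
by move/eqP.
Qed.

(** The count of [dim_reflect_at] is the formula of [refl_along]; arrows leaving [u] contribute
    nothing, as [M] vanishes at their targets. *)
Lemma edimvec_reflect src tgt u (M M' : erep k I A) phi psi :
  refl_along src tgt -> reflects src tgt u (M := M) (M' := M') phi psi ->
  edimvec M' = refl form (alpha u) (edimvec M).
Proof.
move=> H rM; rewrite /edimvec H.
rewrite -sum_alpha1 -big_split /=; apply: eq_bigr => i _; rewrite -scalerDl.
congr (_ *: _); case: eqP => [->|/eqP iu]; last first.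
  by rewrite addr0 (dim_reflect_other rM iu).
have : (\dim (M' u))%:R + (\dim (M u))%:R =
       \sum_a (tgt a == u)%:R * (\dim (M (src a)))%:R :> R.
  rewrite -natrD (dim_reflect_at rM) natr_sum big_mkcond /=.
  by apply: eq_bigr => a _; case: eqP => _; rewrite ?mul1r ?mul0r.
rewrite big_split /= => <-.
rewrite [X in _ + (_ + X - _)]big1 ?addr0; last first.
  move=> a _; case: eqP => [sa|_]; rewrite ?mul0r // mul1r.
  by have [_ ->] := refl_sink rM sa; rewrite dimv0.
by ring.
Qed.

(** All maps of [M] vanish, so the projection onto a line of [M u] is an idempotent endomorphism.
    Being nonzero it is the identity, and [M u] is that line. *)
Lemma eindec_concentrated src tgt u M : estable src tgt M ->
  esink src tgt u M -> eindec src tgt M -> (forall j, j != u -> M j = 0%VS) ->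
  edimvec M = alpha u.
Proof.
move=> stM sM [[i0 Mi0] indM] M0.
have Mu : M u <> 0%VS by move=> Mu; apply: Mi0; case: (eqVneq i0 u) => [->|/M0].
pose v := vpick (M u).
have v0 : v != 0 by rewrite vpick0; apply/eqP.
have vM : (<[v]> <= M u)%VS by rewrite -memvE memv_pick.
pose e i : 'End(amb M) := if i == u then projv <[v]>%VS else 0.
have f0 a y : y \in M (src a) -> emap M a y = 0.
  move=> yM; have [sa|sa] := eqVneq (src a) u.
    have [_ t0] := sM a sa; have := stM a y yM.
    by rewrite t0 memv0 => /eqP.
  by move: yM; rewrite M0 // memv0 => /eqP ->; rewrite linear0.
have eM i x : x \in M i -> e i x \in M i.
  rewrite /e; case: eqP => [-> _|_ _]; last by rewrite zero_lfunE mem0v.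
  by rewrite (subvP vM) ?memv_proj.
have eh : ehom src tgt (M := M) (N := M) e.
  by split=> // a x xM; rewrite !f0 ?eM // linear0.
have eK i x : x \in M i -> e i (e i x) = e i x.
  by rewrite /e; case: eqP => _; rewrite ?projv_proj ?zero_lfunE.
have dimMu : \dim (M u) = 1%N.
  case: (indM e eh eK) => ei.
    have := ei u v (memv_pick _); rewrite /e eqxx projv_id ?memv_line // => v00.
    by rewrite v00 eqxx in v0.
  have -> : M u = <[v]>%VS; last by rewrite dim_vline v0.
  apply/eqP; rewrite eqEsubv vM andbT; apply/subvP => x xM.
  by have := ei u x xM; rewrite /e eqxx => <-; rewrite memv_proj.
rewrite /edimvec -[RHS]scale1r -sum_alpha1; apply: eq_bigr => i _.
by case: eqP => [->|/eqP iu]; rewrite ?dimMu // M0 // dimv0.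
Qed.

(* [L] embeds into a sum of indecomposables [N] as soon as the homomorphisms to
   these [N] separate its points. *)
Lemma closed_cogenerated s src tgt : admissible src tgt s ->
  refl_along src tgt -> forall L, estable src tgt L -> eindec src tgt L ->
  (forall i x, x \in L i -> x != 0 -> exists N (g : I -> 'Hom(amb L, amb N)),
     [/\ estable src tgt N, eindec src tgt N, edimvec N \in word_roots s,
         ehom src tgt g & g i x != 0]) ->
  edimvec L \in word_roots s.
Proof.
elim: s src tgt => [|u s IHs] src tgt.
  move=> _ _ L _ [[i Li] _] /(_ i (vpick (L i)) (memv_pick _)).
  rewrite vpick0 => /(_ (introN eqP Li))[N [g [_ _]]].
  by rewrite in_nil.
move=> [tgtN adm] H L stL indL cogL.
have sinkN N : (forall i, i \notin u :: s -> N i = 0%VS) -> esink src tgt u N.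
  move=> N0 a sa; have ta := tgtN a sa; split; last exact: N0.
  by move: ta; rewrite inE negb_or => /andP[].
have sinkL : esink src tgt u L.
  apply: sinkN => i ius; apply/eqP/negP => /negP; rewrite -vpick0 => v0.
  have [N [g [_ _ dN [gN _]]]] := cogL i _ (memv_pick _) v0.
  have := gN i _ (memv_pick (L i)).
  by rewrite (edimvec_supp H dN ius) memv0 => ->.
case: (pselect (exists2 j, j != u & L j <> 0%VS)) => [ncL|cL]; last first.
  rewrite inE (eindec_concentrated stL sinkL indL) ?eqxx // => j ju.
  by apply/eqP/negP => /negP/eqP Lj; apply: cL; exists j.
have [L' [phi [psi rL]]] :=
  ex_reflect_sink stL sinkL (eindec_sink_surj stL sinkL indL ncL).
(* As [g] is nonzero at a vertex other than [u], its target [N] is not the simple module at [u]; so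
   [N] can be reflected together with [g], and its dimension vector is not the first root of the
   word. *)
have cog' j y : j != u -> y \in L j -> y != 0 ->
    exists (N : erep k I A) (g : I -> 'Hom(amb L', amb N)),
     [/\ estable (flip_src src tgt u) (flip_tgt src tgt u) N,
         eindec (flip_src src tgt u) (flip_tgt src tgt u) N,
         edimvec N \in word_roots s,
         ehom (flip_src src tgt u) (flip_tgt src tgt u) g & g j (phi y) != 0].
  move=> ju yL y0; have [N [g [stN indN dN gh gy]]] := cogL j y yL y0.
  have sinkNN := sinkN N (fun i => edimvec_supp H dN).
  have gyN := gh.1 j y yL.
  have Nj : N j <> 0%VS by move=> Nj; move: gyN gy; rewrite Nj memv0 => ->.
  have := eindec_sink_surj stN sinkNN indN; move/(_ (ex_intro2 _ _ j ju Nj)).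
  move=> /(ex_reflect_sink stN sinkNN)[N' [phiN [psiN rN]]].
  have [g' gh' g'E] := ehom_reflect rL rN gh.
  exists N', g'; split=> //.
  - exact: (refl_stable' rN).
  - exact: eindec_reflect rN indN.
  - rewrite (edimvec_reflect H rN).
    move: dN; rewrite inE => /predU1P[dN|/mapP[b bs ->]]; last by rewrite reflK.
    case: Nj; apply/eqP; rewrite -dimv_eq0; move: dN.
    rewrite -[RHS]scale1r -sum_alpha1 => /alpha_free/(_ j).
    by rewrite (negPf ju) => /eqP; rewrite (eqr_nat _ _ 0).
  - rewrite g'E // !comp_lfunE (refl_phiK rL ju yL).
    apply: contraNneq gy => p0.
    by rewrite -(refl_phiK rN ju gyN) p0 linear0.
suff dL' : edimvec L' \in word_roots s.
  rewrite -[edimvec L](reflK form (alpha u)) -(edimvec_reflect H rL) inE.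
  by rewrite map_f ?orbT.
apply: (IHs _ _ adm (refl_along_flip u H)).
- exact: (refl_stable' rL).
- exact: eindec_reflect rL indL.
move=> i x xL x0; have [iu|iu] := eqVneq i u; last first.
  have pL := refl_psi rL iu xL; have pK := refl_psiK rL iu xL.
  have p0 : psi x != 0.
    by apply: contraNneq x0 => p0; rewrite -pK p0 linear0.
  by have := cog' i (psi x) iu pL p0; rewrite pK.
rewrite iu in xL *.
(* A vector at [u] is tested through its neighbours: some reversed arrow sends [x] to a nonzero
   vector, and a homomorphism detecting the latter also detects [x], by commutation with the
   arrow. *)
have [a ta ax] : exists2 a, tgt a = u & emap L' a x != 0.
  case: (pselect (exists2 a, tgt a = u & emap L' a x != 0)) => // nx.
  case/eqP: x0; apply: (refl_inj rL) => // a ta.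
  by apply/eqP/negP => /negP xa; case: nx; exists a.
have sa := sink_srcN (refl_sink rL) ta.
have axL : emap L' a x \in L' (src a).
  exact: stable_flip_in (refl_sink' rL) (refl_stable' rL) ta xL.
have pK := refl_psiK rL sa axL.
have p0 : psi (emap L' a x) != 0.
  by apply: contraNneq ax => p0; rewrite -pK p0 linear0.
have [N [g [stN indN dN gh gx]]] := cog' _ _ sa (refl_psi rL sa axL) p0.
exists N, g; split=> //; apply: contraNneq gx => gx.
have := gh.2 a x; rewrite /flip_src /flip_tgt ta eqxx orbT => /(_ xL).
by rewrite pK gx linear0 => ->.
Qed.

Lemma ex_simple_erep src tgt u : (forall a, src a = u -> tgt a <> u) ->
  exists M : erep k I A,
    [/\ estable src tgt M, eindec src tgt M & edimvec M = alpha u].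
Proof.
move=> noloop; pose M := @Erep k I A k^o
  (fun i => if i == u then fullv else 0%VS) (fun=> 0).
have dM i : \dim (M i) = (i == u).
  by rewrite /=; case: eqP => _; rewrite ?dimv0 // dimvf.
have M0 i x : i != u -> x \in M i -> x = 0.
  by move=> /negPf /= ->; rewrite memv0 => /eqP.
exists M; split.
- by move=> a x _; rewrite zero_lfunE mem0v.
- split=> [|e _ eK].
    by exists u => /eqP; rewrite -dimv_eq0 dM eqxx.
  have eE (x : k^o) : e u x = x *: e u (1 : k^o).
    by rewrite -linearZ; congr (e u _); rewrite /GRing.scale /= mulr1.
  have Mu (x : k^o) : x \in M u by rewrite /= eqxx memvf.
  have : (e u (1 : k^o) : k) * ((e u (1 : k^o) : k) - 1) == 0.
    by rewrite mulrBr mulr1 subr_eq0; have := eK u _ (Mu 1); rewrite eE => /eqP.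
  rewrite mulf_eq0 subr_eq0 => /orP[/eqP e1|/eqP e1]; [left|right] => i x xM;
    (have [iu|iu] := eqVneq i u; last by rewrite (M0 i x iu xM) linear0).
    by rewrite iu eE e1 scaler0.
  by rewrite iu eE e1 /GRing.scale /= mulr1.
rewrite -[RHS]scale1r -sum_alpha1; apply: eq_bigr => i _.
by rewrite dM; case: eqP.
Qed.

(** A module for the corresponding root of the tail is reflected back at [u]. This could fail only
    for a module concentrated at [u]; its root would be a positive multiple of [alpha u], whose
    reflection has a negative coordinate, against [nonneg_word]. *)
Lemma word_roots_realized s src tgt : admissible src tgt s ->
  refl_along src tgt -> nonneg_word s -> forall b, b \in word_roots s ->
  exists M : erep k I A,
    [/\ estable src tgt M, eindec src tgt M & edimvec M = b].
Proof.
elim: s src tgt => [//|u s IHs] src tgt [tgtN adm] H [posb poss] b.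
rewrite {1}/word_roots -/word_roots inE => /predU1P[->|].
  apply: ex_simple_erep => a /tgtN; rewrite inE negb_or => /andP[tu _].
  exact/eqP.
case/mapP=> b' bs ->.
have [M' [stM indM dM]] := IHs _ _ adm (refl_along_flip u H) poss b' bs.
have sM : esink src tgt u M'.
  move=> a /tgtN ta; move: (ta); rewrite inE negb_or => /andP[tu ts].
  by split=> //; apply: (edimvec_supp H) ts; rewrite dM.
have ncM : exists2 j, j != u & M' j <> 0%VS.
  case: (pselect (exists2 j, j != u & M' j <> 0%VS)) => // cM.
  have M0 j : j != u -> M' j = 0%VS.
    by move=> ju; apply/eqP/negP => /negP/eqP Mj; apply: cM; exists j.
  have [i0 Mi0] := indM.1.
  have Mu : \dim (M' u) != 0%N.
    rewrite dimv_eq0; apply/eqP => Mu; apply: Mi0.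
    by have [->|/M0] := eqVneq i0 u.
  have [|c] := posb (refl form (alpha u) b').
    by rewrite /= inE map_f ?orbT.
  have -> : b' = (\dim (M' u))%:R *: alpha u.
    rewrite -dM -sum_alpha1; apply: eq_bigr => i _.
    by case: eqP => [->//|/eqP/M0->]; rewrite dimv0.
  rewrite linearZ /= refl_self scalerN -scaleNr -sum_alpha1.
  move/alpha_free/(_ u)/eqP; rewrite eqxx eq_sym -subr_eq0 opprK -natrD.
  by rewrite (eqr_nat _ _ 0) addn_eq0 (negPf Mu) andbF.
have [M [phi [psi rM]]] := ex_reflect_source stM sM (eindec_source_inj stM sM indM ncM).
exists M; split; first exact: (refl_stable rM).
  exact: eindec_unreflect rM indM.
by rewrite -dM (edimvec_reflect H rM) reflK.
Qed.

End WordRoots.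

(** * Sortable words are admissible *)

Section SortableWords.

Variable I : eqType.
Implicit Types (i j x : I) (s t c : seq I).

(* For an arrow [i <- j] this says that, when the letters of [s] are processed
   as reflections, each letter [i] or [j] is a sink of the current orientation
   or is followed by no letter at the other end of the arrow. *)
Fixpoint alternating i j s : bool :=
  if s is x :: s' then
    if x == i then alternating j i s'
    else if x == j then i \notin s' else alternating i j s'
  else true.

Lemma alternating_absent i j s : (i \notin s) || (j \notin s) ->
  alternating i j s.
Proof.
elim: s i j => //= x s IHs i j; rewrite !inE !negb_or ![_ == x]eq_sym.
case: eqP => [_|_] /=; last by case: eqP; rewrite ?orbF // => _ /IHs.
by case: eqP => //= _ js; apply: IHs; rewrite js.
Qed.

Lemma alternating_skip i j s r : i \notin s -> j \notin s ->
  alternating i j (s ++ r) = alternating i j r.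
Proof.
elim: s => //= x s IHs; rewrite !inE !negb_or ![_ == x]eq_sym.
by move=> /andP[/negPf -> ins] /andP[/negPf -> jns]; apply: IHs.
Qed.

(** Either both letters occur in the block [t], with [i] before [j], and after [t] the roles of [i]
    and [j] are the initial ones; or one of them is missing from [t] and, supports being nested,
    never occurs again. *)
Lemma alternating_block i j t r :
  i != j -> uniq t -> pairwise (fun x y => ~~ ((x == j) && (y == i))) t ->
  (i \notin t -> i \notin r) -> (j \notin t -> j \notin r) ->
  alternating i j r -> alternating i j (t ++ r).
Proof.
move=> ij ut pt ir jr altr; have [it|it] := boolP (i \in t); last first.
  by apply: alternating_absent; rewrite mem_cat negb_or it ir.
case/splitPr: it ut pt ir jr => t1 t2.
rewrite cat_uniq pairwise_cat /= => /and3P[_ /norP[it1 _] /andP[it2 ut2]].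
move=> /and3P[/allrelP pt _ _] _ jr.
have jt1 : j \notin t1.
  by apply/negP => /(pt j i)/(_ (mem_head _ _)); rewrite !eqxx.
rewrite -catA alternating_skip //= eqxx.
have [jt|jt] := boolP (j \in t2); last first.
  apply: alternating_absent; rewrite mem_cat negb_or jt jr //.
  by rewrite mem_cat inE !negb_or jt1 jt eq_sym ij.
case/splitPr: jt ut2 it2 jr => t3 t4; rewrite cat_uniq.
case/and3P=> _ /norP[jt3 _] /andP[jt4 _].
rewrite mem_cat inE !negb_or => /and3P[it3 _ it4] _.
by rewrite -catA alternating_skip //= eqxx alternating_skip.
Qed.

(** The order of the two letters is put in a pairwise form because that form is inherited by
    subwords. *)
Lemma index_lt_pairwise i j c : (index i c < index j c)%N ->
  uniq c -> pairwise (fun x y => ~~ ((x == j) && (y == i))) c.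
Proof.
move=> ltij uc; apply/(pairwiseP i) => m n; rewrite !inE => ms ns lemn.
apply/negP => /andP[/eqP mj /eqP ni]; move: ltij.
by rewrite -{1}ni -mj !index_uniq // ltnNge ltnW.
Qed.

Lemma alternating_sortable i j c cs : i != j -> uniq c ->
  (index i c < index j c)%N -> all (fun s => subseq s c) cs ->
  sorted (fun s t => all (mem s) t) cs -> alternating i j (flatten cs).
Proof.
move=> ij uc /index_lt_pairwise/(_ uc) pc.
elim: cs => //= t cs IHs /andP[tc csc] pt.
have memr x : x \notin t -> x \notin flatten cs.
  apply: contraNN => /flattenP[s scs xs].
  have tr : transitive (fun s t : seq I => all (mem s) t).
    by move=> s1 s2 s3 /allP s12 /allP s13; apply/allP => y /s13/s12.
  by have /allP/(_ s scs)/allP := order_path_min tr pt; apply.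
apply: alternating_block => //; try exact: memr.
- exact: subseq_uniq tc uc.
- exact: subseq_pairwise tc pc.
- exact: IHs csc (path_sorted pt).
Qed.

End SortableWords.

(** Reading a letter swaps the arguments of [alternating] just as reversing the arrows there swaps
    source and target. If the letter is the source of an arrow, the target no longer occurs, and the
    arrow imposes nothing further. *)
Lemma admissible_alternating (I A : finType) (src tgt : A -> I) (s : seq I) :
  (forall a, src a != tgt a) ->
  (forall a, alternating (tgt a) (src a) s) -> admissible src tgt s.
Proof.
elim: s src tgt => //= u s IHs src tgt noloop alt; split.
  move=> a sa; have tu : tgt a != u by rewrite -sa eq_sym.
  have := alt a; rewrite sa eqxx inE negb_or tu.
  by rewrite [u == _]eq_sym (negPf tu).
apply: IHs => a; rewrite /flip_src /flip_tgt.
  by case: ifP => _; rewrite // eq_sym.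
have := alt a; have := noloop a.
case: (eqVneq (tgt a) u) => [ta|tu]; rewrite ?orbT ?orbF //.
case: (eqVneq (src a) u) => // sa _ ts.
by apply: alternating_absent; rewrite ts orbT.
Qed.

(** * Inversions and Bruhat inversions *)

Lemma perm_map_invol (T : eqType) (f : T -> T) (s : seq T) : uniq s ->
  {in s, forall x, f x \in s} -> {in s, forall x, f (f x) = x} ->
  perm_eq (map f s) s.
Proof.
move=> us fs fK; apply: uniq_perm => //.
  by rewrite map_inj_in_uniq // => x y xs ys /(congr1 f); rewrite !fK.
move=> y; apply/mapP/idP => [[x xs ->]|ys]; first exact: fs.
by exists (f y); rewrite ?fs ?fK.
Qed.

Section Roots.

Variables (R : realType) (V : vectType R) (form : {dot V for idfun}).
Variables (I : finType) (alpha : I -> V) (Phi : seq V).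
Hypotheses (hPhi : is_root_system form Phi) (halpha : is_simple_system alpha Phi).
Hypothesis simple_norm : forall i j, form (alpha i) (alpha i) = form (alpha j) (alpha j).

Let basis_tuple := map_tuple alpha (enum_tuple I).

Definition simple_coord (i : I) (x : V) : R :=
  coord basis_tuple (enum_rank i) x.
Local Notation ct := simple_coord.

Lemma basis_tupleE i : basis_tuple`_(enum_rank i) = alpha i.
Proof.
by rewrite (nth_map i) -?cardE //; congr alpha; rewrite -enum_val_nth enum_rankK.
Qed.

Lemma ct_sum x : x = \sum_i ct i x *: alpha i.
Proof.
have [_ bas _] := halpha.
rewrite {1}(coord_basis (X := basis_tuple) bas (memvf x)).
rewrite (reindex enum_rank) /=; last first.
  by exists enum_val => i _; rewrite ?enum_rankK ?enum_valK.
by apply: eq_bigr => i _; rewrite basis_tupleE.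
Qed.

Lemma ctD i x y : ct i (x + y) = ct i x + ct i y.
Proof. exact: linearD. Qed.
Lemma ctN i x : ct i (- x) = - ct i x.
Proof. exact: linearN. Qed.
Lemma ctZ i c x : ct i (c *: x) = c * ct i x.
Proof. exact: linearZ. Qed.
Lemma ct_big i J (r : seq J) (P : pred J) (F : J -> V) :
  ct i (\sum_(j <- r | P j) F j) = \sum_(j <- r | P j) ct i (F j).
Proof. exact: linear_sum. Qed.

Lemma ct_alpha i j : ct i (alpha j) = (i == j)%:R.
Proof.
have [_ /basis_free fr _] := halpha.
by rewrite /ct -basis_tupleE coord_free // (inj_eq enum_rank_inj) eq_sym.
Qed.

Lemma ct_lin i (c : I -> R) : ct i (\sum_j c j *: alpha j) = c i.
Proof.
rewrite ct_big (bigD1 i) //= ctZ ct_alpha eqxx mulr1 big1 ?addr0 // => j.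
by rewrite ctZ ct_alpha eq_sym => /negPf ->; rewrite mulr0.
Qed.

Lemma simple_free (c d : I -> R) :
  \sum_i c i *: alpha i = \sum_i d i *: alpha i -> c =1 d.
Proof. by move=> cd i; rewrite -(ct_lin i c) cd ct_lin. Qed.

(** On roots, its sign separates positive from negative ones ([pos_rootE], [neg_rootE]). Being
    linear, it turns statements about signs of sums of roots into inequalities. *)
Definition height (x : V) : R := \sum_i ct i x.
Local Notation ht := height.

Lemma htD x y : ht (x + y) = ht x + ht y.
Proof. by rewrite -big_split; apply: eq_bigr => i _; rewrite ctD. Qed.
Lemma htN x : ht (- x) = - ht x.
Proof. by rewrite -sumrN; apply: eq_bigr => i _; rewrite ctN. Qed.
Lemma htZ c x : ht (c *: x) = c * ht x.
Proof. by rewrite mulr_sumr; apply: eq_bigr => i _; rewrite ctZ. Qed.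
Lemma ht0 : ht 0 = 0.
Proof. by rewrite -(scale0r 0) htZ mul0r. Qed.
Lemma ht_big J (r : seq J) (P : pred J) (F : J -> V) :
  ht (\sum_(j <- r | P j) F j) = \sum_(j <- r | P j) ht (F j).
Proof. exact: (big_morph ht htD ht0). Qed.

Lemma ht_alpha i : ht (alpha i) = 1.
Proof.
rewrite /ht (bigD1 i) //= ct_alpha eqxx big1 ?addr0 // => j /negPf ji.
by rewrite ct_alpha ji.
Qed.

Lemma root_neq0 b : b \in Phi -> b != 0.
Proof. by have [[Phi0 _] _ _ _] := hPhi; apply: contraTneq => ->. Qed.

Lemma refl_root a b : a \in Phi -> b \in Phi -> refl form a b \in Phi.
Proof. by have [_ _ H _] := hPhi; apply: H. Qed.

Lemma simple_root i : alpha i \in Phi.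
Proof. by have [[_ H] _ _] := halpha. Qed.

Lemma opp_root b : b \in Phi -> - b \in Phi.
Proof. by move=> bP; rewrite -(refl_self form) refl_root. Qed.

Lemma pos_rootE b : pos_root alpha Phi b <-> b \in Phi /\ 0 < ht b.
Proof.
have pos_ht c : 0 <= ht (\sum_i (c i)%:R *: alpha i).
  by apply: sumr_ge0 => i _; rewrite ct_lin ler0n.
have ht_neq0 c : b \in Phi -> b = \sum_i (c i)%:R *: alpha i -> 0 < ht b.
  move=> /root_neq0 b0 bE; rewrite lt_def bE pos_ht andbT.
  apply: contraNneq b0 => h0.
  rewrite bE big1 // => i _; have /eqP := h0; rewrite psumr_eq0; last first.
    by move=> j _; rewrite ct_lin ler0n.
  by move/allP/(_ i (mem_index_enum _)); rewrite ct_lin => /eqP ->; rewrite scale0r.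
split=> [[bP [c bE]]|[bP hb]]; first by split=> //; apply: ht_neq0 bP bE.
have [_ _ /(_ b bP)[//|[_ [c bE]]]] := halpha.
by move: hb; rewrite bE htN oppr_gt0 ltNge pos_ht.
Qed.

Lemma neg_rootE b : neg_root alpha Phi b <-> b \in Phi /\ ht b < 0.
Proof.
have -> : neg_root alpha Phi b <-> pos_root alpha Phi (- b).
  split=> -[bP [c bE]].
    by split; [exact: opp_root|exists c; rewrite bE opprK].
  by split; [rewrite -[b]opprK opp_root|exists c; rewrite -bE opprK].
rewrite pos_rootE htN oppr_gt0; split=> -[bP hb]; split=> //.
  by rewrite -[b]opprK opp_root.
exact: opp_root.
Qed.

Lemma ht_root b : b \in Phi -> (ht b < 0) = ~~ (0 < ht b).
Proof.
move=> bP; rewrite -leNgt lt_neqAle; case: eqP => //= hb.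
have [_ _ /(_ b bP)[/pos_rootE|/neg_rootE]] := halpha;
  by rewrite hb ltxx => -[].
Qed.

Lemma pos_nat b : b \in Phi -> 0 < ht b -> exists c : I -> nat, forall i, ct i b = (c i)%:R.
Proof.
move=> bP hb; have /pos_rootE[_ [c ->]] := conj bP hb.
by exists c => i; rewrite ct_lin.
Qed.

Lemma pos_ct b i : b \in Phi -> 0 < ht b -> 0 <= ct i b.
Proof. by move=> bP hb; have [c ->] := pos_nat bP hb. Qed.

Lemma ct_refl i j x : i != j -> ct j (refl form (alpha i) x) = ct j x.
Proof.
by move=> ij; rewrite reflE ctD ctN ctZ ct_alpha eq_sym (negPf ij) mulr0 subr0.
Qed.

(** Only the coordinate at [i] changes. If the reflected root were negative, all other coordinates
    would be both nonnegative and nonpositive, and [b] would be a multiple of [alpha i], hence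
    [alpha i] itself. *)
Lemma refl_simple_pos i b : b \in Phi -> 0 < ht b -> b != alpha i ->
  0 < ht (refl form (alpha i) b).
Proof.
move=> bP hb bi.
have rP : refl form (alpha i) b \in Phi by rewrite refl_root ?simple_root.
rewrite -[0 < _]negbK -ht_root //; apply/negP => hr.
have ct0 j : i != j -> ct j b = 0.
  move=> ij; apply/eqP; rewrite eq_le (pos_ct _ bP) // andbT.
  rewrite -(ct_refl _ ij) -oppr_ge0 -ctN pos_ct ?opp_root //.
  by rewrite htN oppr_gt0.
have bE : b = ct i b *: alpha i.
  rewrite [LHS]ct_sum (bigD1 i) //= big1 ?addr0 // => j; rewrite eq_sym => ij.
  by rewrite ct0 // scale0r.
have [_ red _ _] := hPhi.
have [] := red (alpha i) (ct i b) (simple_root i); first by rewrite -bE.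
  by move=> c1; move: bi; rewrite bE c1 scale1r eqxx.
by move=> c1; have := pos_ct i bP hb; rewrite c1 oppr_ge0 ler10.
Qed.

Local Notation W := (word_prod form alpha).

Lemma word_cat s t x : W (s ++ t) x = W s (W t x).
Proof. by elim: s => [|i s IHs] /=; rewrite ?id_lfunE // !comp_lfunE IHs. Qed.

Lemma word_cons i s x : W (i :: s) x = refl form (alpha i) (W s x).
Proof. by rewrite /= comp_lfunE. Qed.

Lemma word_revK s : cancel (W s) (W (rev s)).
Proof.
elim: s => [|i s IHs] x; first by rewrite /= !id_lfunE.
by rewrite rev_cons -cats1 word_cat !word_cons /= id_lfunE reflK IHs.
Qed.

Lemma word_revVK s : cancel (W (rev s)) (W s).
Proof. by rewrite -{2}[s]revK; apply: word_revK. Qed.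

Lemma word_rev_cons i s x : W (rev (i :: s)) x = W (rev s) (refl form (alpha i) x).
Proof. by rewrite rev_cons -cats1 word_cat /= comp_lfunE id_lfunE. Qed.

Lemma word_root s b : b \in Phi -> W s b \in Phi.
Proof.
move=> bP; elim: s => [|i s IHs]; rewrite /= ?id_lfunE // comp_lfunE.
by rewrite refl_root ?simple_root.
Qed.

Lemma form_word s x y : form (W s x) (W s y) = form x y.
Proof.
elim: s => [|i s IHs]; rewrite /= ?id_lfunE // !comp_lfunE.
by rewrite form_refl.
Qed.

Lemma inversionE s b : inversion alpha Phi (W s) b <->
  [/\ b \in Phi, 0 < ht b & ht (W (rev s) b) < 0].
Proof.
rewrite /inversion pos_rootE; split=> [[[bP hb] [g /neg_rootE[gP hg] bE]]|[bP hb hw]].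
  by split=> //; rewrite bE word_revK.
split=> //; exists (W (rev s) b); last by rewrite word_revVK.
by apply/neg_rootE; rewrite word_root.
Qed.

Lemma refl_refl a b x :
  refl form (refl form a b) x = refl form a (refl form b (refl form a x)).
Proof.
rewrite (reflE _ (refl form a b)) (reflE _ b).
rewrite [refl form a (_ - _)]linearB /= [refl form a (_ *: _)]linearZ /= reflK.
by rewrite form_refl -(form_refl form a x) reflK.
Qed.

(** The root [g] is followed through the word; when it meets the current simple root, that letter
    cancels against the reflection. Such a meeting must occur, since otherwise [g] would stay
    positive. *)
Lemma strong_exchange s g : g \in Phi -> 0 < ht g -> ht (W (rev s) g) < 0 ->
  exists2 s', size s = (size s').+1 & (refl form g \o W s)%VF = W s'.
Proof.
elim: s g => [|i s IHs] g gP hg.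
  by rewrite /= id_lfunE ltNge ltW.
rewrite word_rev_cons; have [-> _|gi hw] := eqVneq g (alpha i).
  by exists s => //; apply/lfunP => x; rewrite /= !comp_lfunE reflK.
have [||s' ss' s'E] := IHs _ _ _ hw.
- by rewrite refl_root ?simple_root.
- exact: refl_simple_pos.
exists (i :: s'); first by rewrite /= ss'.
apply/lfunP => x; rewrite word_cons -s'E !comp_lfunE refl_refl.
by rewrite reflK.
Qed.

Lemma weyl_length_min s : (weyl_length form alpha (W s) <= size s)%N.
Proof.
have hs : has_word form alpha (W s) (size s).
  by apply/existsP; exists (in_tuple s).
rewrite /weyl_length; case: pselect => // e; case: ex_minnP => n _; exact.
Qed.

Lemma reduced_word s : exists2 s', W s' = W s & size s' = weyl_length form alpha (W s).
Proof.
have hs : exists n, has_word form alpha (W s) n.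
  by exists (size s); apply/existsP; exists (in_tuple s).
rewrite /weyl_length; case: pselect => // e.
case: ex_minnP => n /existsP[t /eqP tE] _.
by exists t => //; rewrite size_tuple.
Qed.

(** The list [Phi] may contain repetitions, which would spoil the count of inversions. *)
Definition pos_roots : seq V := [seq b <- undup Phi | 0 < ht b].

Lemma mem_pos_roots b : (b \in pos_roots) = (b \in Phi) && (0 < ht b).
Proof. by rewrite mem_filter mem_undup andbC. Qed.

Lemma uniq_pos_roots : uniq pos_roots.
Proof. by rewrite filter_uniq ?undup_uniq. Qed.

Definition ninv (s : seq I) : nat := \sum_(b <- pos_roots) (ht (W (rev s) b) < 0)%R.

Definition abs_root (b : V) : V := if 0 < ht b then b else - b.

(** Reindexing along the involution [b -> abs_root (refl form g b)] of the positive roots. Where the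
    reflection makes [b] negative, a sign is inserted and the condition is reversed. *)
Lemma sum_refl_roots g s : g \in Phi ->
  (\sum_(b <- pos_roots) (ht (W s (refl form g b)) < 0)%R =
   \sum_(b <- pos_roots)
     (if 0 < ht (refl form g b) then ht (W s b) < 0 else 0 < ht (W s b))%R)%N.
Proof.
move=> gP; pose f b := abs_root (refl form g b).
have fP b : b \in pos_roots -> f b \in pos_roots.
  rewrite !mem_pos_roots /f /abs_root => /andP[bP hb].
  have rP := refl_root gP bP; case: ifPn => hr; first by rewrite rP hr.
  by rewrite opp_root // htN oppr_gt0 ht_root.
have fK b : b \in pos_roots -> f (f b) = b.
  rewrite mem_pos_roots /f /abs_root => /andP[bP hb].
  case: (ifPn (0 < ht (refl _ _ b))) => _; first by rewrite reflK hb.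
  by rewrite linearN /= reflK htN oppr_gt0 ltNge ltW //= opprK.
have fp : perm_eq (map f pos_roots) pos_roots.
  by apply: perm_map_invol => //; apply: uniq_pos_roots.
rewrite -(perm_big _ fp) big_map /= big_seq_cond [RHS]big_seq_cond.
apply: eq_bigr => b; rewrite andbT mem_pos_roots => /andP[bP hb].
have rP := refl_root gP bP.
have -> : refl form g (f b) = if 0 < ht (refl form g b) then b else - b.
  by rewrite /f /abs_root; case: ifP; rewrite ?linearN /= reflK.
have wP := word_root s bP.
case: ifP => _ //; by rewrite linearN /= htN oppr_lt0.
Qed.

Lemma ninv_ext s s' : W s = W s' -> ninv s = ninv s'.
Proof.
move=> ss'; apply: eq_bigr => b _; congr (nat_of_bool (ht _ < 0)).
by rewrite -[LHS](word_revK s') -ss' word_revVK.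
Qed.

(** The simple reflection permutes the positive roots other than [alpha u], which itself passes from
    non-inversion to inversion. *)
Lemma ninv_cons u s : 0 < ht (W (rev s) (alpha u)) -> ninv (u :: s) = (ninv s).+1.
Proof.
move=> hu; have uP : alpha u \in pos_roots.
  by rewrite mem_pos_roots simple_root ht_alpha ltr01.
have -> : ninv (u :: s) =
    (\sum_(b <- pos_roots) (ht (W (rev s) (refl form (alpha u) b)) < 0)%R)%N.
  by apply: eq_bigr => b _; rewrite word_rev_cons.
rewrite sum_refl_roots ?simple_root // /ninv.
rewrite (bigD1_seq (alpha u)) ?uniq_pos_roots //=.
rewrite [in RHS](bigD1_seq (alpha u)) ?uniq_pos_roots //=.
rewrite refl_self htN ht_alpha oppr_gt0 ltr10 hu [_ < 0]ltNge ltW //= add1n add0n.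
congr _.+1; rewrite big_seq_cond [RHS]big_seq_cond.
apply: eq_bigr => b; rewrite mem_pos_roots => /andP[/andP[bP hb] bu].
by rewrite refl_simple_pos.
Qed.

(** If the inverse of the tail made [alpha u] negative, [strong_exchange] would express the whole
    product by a word with two letters fewer. *)
Lemma reduced_tail u s : size (u :: s) = weyl_length form alpha (W (u :: s)) ->
  size s = weyl_length form alpha (W s) /\ 0 < ht (W (rev s) (alpha u)).
Proof.
move=> red; split.
  have [s' s'E s'l] := reduced_word s.
  apply/eqP; rewrite eqn_leq weyl_length_min -s'l andbT -ltnS.
  change ((size (u :: s) <= size (u :: s'))%N); rewrite red.
  by rewrite (_ : W (u :: s) = W (u :: s')) ?weyl_length_min //= s'E.
rewrite -[0 < _]negbK -ht_root ?word_root ?simple_root //; apply/negP => hu.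
have [||s' ss' s'E] := strong_exchange _ _ hu.
- exact: simple_root.
- by rewrite ht_alpha.
have := weyl_length_min s'; rewrite -s'E leqNgt.
by move: red => /= <-; rewrite ss' leqW.
Qed.

Lemma ninv_reduced s : size s = weyl_length form alpha (W s) -> ninv s = size s.
Proof.
elim: s => [|u s IHs].
  move=> _; rewrite /ninv big_seq big1 // => b.
  by rewrite mem_pos_roots id_lfunE => /andP[_ hb]; rewrite ltNge ltW.
by move=> /reduced_tail[/IHs sE hu]; rewrite ninv_cons ?sE.
Qed.

Lemma weyl_length_ninv s : weyl_length form alpha (W s) = ninv s.
Proof.
have [s' s'E s'l] := reduced_word s.
by rewrite -s'l -(ninv_ext s'E) ninv_reduced // s'E.
Qed.

(** Since the tail does not invert [alpha u], the reflection at [u] carries the inversions of the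
    tail bijectively to those of the whole word other than [alpha u]. *)
Lemma word_roots_inversion s b : size s = weyl_length form alpha (W s) ->
  b \in word_roots form alpha s <-> inversion alpha Phi (W s) b.
Proof.
rewrite inversionE; elim: s b => [|u s IHs] b.
  move=> _; split=> // -[_ hb]; rewrite id_lfunE ltNge ltW //.
move=> /reduced_tail[/IHs{}IHs hu]; rewrite word_rev_cons inE; split.
  case/predU1P=> [->|/mapP[b' /IHs[bP hb hw] ->]].
    rewrite simple_root ht_alpha ltr01 refl_self linearN /= htN oppr_lt0.
    by rewrite hu.
  rewrite refl_root ?simple_root // reflK; split=> //.
  apply: refl_simple_pos => //; apply: contraTneq hu => <-.
  by rewrite -ht_root ?word_root.
move=> [bP hb hw]; have [//|bu] := eqVneq b (alpha u).
rewrite -[b](reflK form (alpha u)) map_f //; apply/IHs.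
by rewrite refl_root ?simple_root // refl_simple_pos.
Qed.

Lemma reduced_nonneg_word s : size s = weyl_length form alpha (W s) ->
  nonneg_word form alpha s.
Proof.
elim: s => // u s IHs red; split; last by have [/IHs] := reduced_tail red.
by move=> b /word_roots_inversion -/(_ red)[[_ []]] c bE _; exists c.
Qed.

Lemma root_int a b : a \in Phi -> b \in Phi -> exists n : int, cartan_number form a b = n%:~R.
Proof.
by have [_ _ _ H] := hPhi => aP bP; have /intrP[n ->] := H b a bP aP; exists n.
Qed.

(** Descent on the sum of the coordinates: (b, b) > 0 is a combination of the (b, alpha i) with
    nonnegative coefficients, so one of these is positive, and reflecting in that [alpha i] lowers
    the coordinate at [i] alone. *)
Lemma root_conj_simple b : b \in Phi -> 0 < ht b ->
  exists s u, b = W s (alpha u).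
Proof.
move=> bP hb; have [c bc] := pos_nat bP hb.
have [n] := ubnP (\sum_i c i)%N; elim: n b bP hb c bc => // n IHn b bP hb c bc cn.
case: (pselect (exists u, b = alpha u)) => [[u ->]|bs].
  by exists [::], u; rewrite id_lfunE.
have [i bi] : exists i, 0 < form b (alpha i).
  case: (pselect (exists i, 0 < form b (alpha i))) => // ni.
  have := form_gt0 form (root_neq0 bP); rewrite {2}[b]ct_sum linear_sumr /=.
  rewrite ltNge sumr_le0 // => i _; rewrite linearZr_LR /= mulr_ge0_le0 ?pos_ct //.
  by rewrite leNgt; apply/negP => bi; apply: ni; exists i.
have aii := form_gt0 form (root_neq0 (simple_root i)).
have rP : refl form (alpha i) b \in Phi by rewrite refl_root ?simple_root.
have hr : 0 < ht (refl form (alpha i) b).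
  by apply: refl_simple_pos => //; apply/eqP => bE; apply: bs; exists i.
have [c' rc'] := pos_nat rP hr.
have c'j j : j != i -> c' j = c j.
  move=> ji; apply/eqP; rewrite -(eqr_nat R) -rc' -bc ct_refl //.
  by rewrite eq_sym.
have c'i : (c' i < c i)%N.
  rewrite -(ltr_nat R) -rc' -bc reflE ctD ctN ctZ ct_alpha eqxx mulr1.
  by rewrite ltrBlDr ltrDl divr_gt0 // mulr_gt0.
have [|s [u sE]] := IHn _ rP hr c' rc'.
  apply: leq_trans _ (cn : (\sum_i c i <= n)%N).
  rewrite (bigD1 i) //= [in leqRHS](bigD1 i) //=.
  by rewrite (eq_bigr c) ?ltn_add2r // => j; apply: c'j.
by exists (i :: s), u; rewrite word_cons -sE reflK.
Qed.

Lemma refl_root_word b : b \in Phi -> 0 < ht b -> exists s, refl form b = W s.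
Proof.
move=> bP hb; have [s [u ->]] := root_conj_simple bP hb.
exists (s ++ u :: rev s); apply/lfunP => x.
rewrite word_cat word_cons; elim: s x => [|i s IHs] x.
  by rewrite /= !id_lfunE.
by rewrite word_cons refl_refl IHs word_rev_cons word_cons.
Qed.

Lemma root_norm b u : b \in Phi -> form b b = form (alpha u) (alpha u).
Proof.
move=> bP; wlog hb : b bP / 0 < ht b.
  move=> H; case: (ltP 0 (ht b)) => [|hb]; first exact: H.
  have := H (- b); rewrite linearNr linearNl opprK; apply; first exact: opp_root.
  by rewrite htN oppr_gt0 ht_root // -leNgt.
have [s [v ->]] := root_conj_simple bP hb.
by rewrite form_word (simple_norm v u).
Qed.

(** The Cartan number is a positive integer, and it is less than 2 because (a - b, a - b) > 0 while
    all roots have the same norm. *)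
Lemma root_sub a b : a \in Phi -> b \in Phi -> a != b -> 0 < form a b ->
  refl form b a = a - b.
Proof.
move=> aP bP ab fab; 
have bb := form_gt0 form (root_neq0 bP).
have [n nE] := root_int aP bP; rewrite reflE -/(cartan_number form a b) nE.
suff -> : n = 1 by rewrite scale1r.
have n0 : 0 < n by rewrite -(ltr_int R) -nE divr_gt0 // mulr_gt0.
have n2 : n < 2.
  rewrite -(ltr_int R) -nE ltr_pdivrMr //.
  have nab : form a a = form b b.
    case: (pickP I) => [u _|nI]; first by rewrite !(root_norm u).
    by have := root_neq0 aP; rewrite [a]ct_sum big_pred0 ?eqxx.
  have : 0 < form (a - b) (a - b) by rewrite form_gt0 // subr_eq0.
  rewrite linearBr !linearBl /= nab (dotC form b a); lra.
by apply/eqP; rewrite eq_le -ltzD1 n2 -gtz0_ge1 n0.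
Qed.

(** For [F j] with (b, F j) > 0 the difference [b - F j] is a root by [root_sub]. It is also a
    nonempty sum of inversions, so its height and that of its image under the inverse of [W s] have
    the signs required of an inversion. *)
Lemma sum_root_split s b (J : finType) (F : J -> V) : b \in Phi ->
  (forall j, inversion alpha Phi (W s) (F j)) -> (1 < #|J|)%N ->
  b = \sum_j F j ->
  exists g d, [/\ inversion alpha Phi (W s) g, inversion alpha Phi (W s) d & b = g + d].
Proof.
move=> bP /(_ _)/inversionE FI J1 bE.
have [j bj] : exists j, 0 < form b (F j).
  case: (pselect (exists j, 0 < form b (F j))) => // ni.
  have := form_gt0 form (root_neq0 bP); rewrite {2}bE linear_sumr /=.
  rewrite ltNge sumr_le0 // => j _.
  by rewrite leNgt; apply/negP => bi; apply: ni; exists j.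
have [FP hF hwF] := FI j.
have restE : b - F j = \sum_(i | i != j) F i by rewrite bE (bigD1 j) //= addrAC subrr add0r.
have [i ij] : exists i, i != j.
  by have /card_gt1P[x [y [_ _ xy]]] := J1; have [<-|] := eqVneq x j;
    [exists y; rewrite eq_sym|exists x].
have hrest : 0 < ht (b - F j).
  rewrite restE ht_big (bigD1 i) //= ltr_pwDl //; first by have [] := FI i.
  by apply: sumr_ge0 => l _; have [_ /ltW] := FI l.
have bF : b != F j by apply: contraTneq hrest => ->; rewrite subrr ht0 ltxx.
exists (F j), (b - F j); split; [exact/inversionE| |by rewrite addrC subrK].
apply/inversionE; split=> //.
  by rewrite -root_sub // refl_root.
rewrite restE linear_sum /= ht_big (bigD1 i) //= -oppr_gt0 opprD ltr_pwDl //.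
  by rewrite oppr_gt0; have [] := FI i.
by rewrite oppr_ge0 sumr_le0 // => l _; have [_ _ /ltW] := FI l.
Qed.

Lemma weyl_length_refl s b : b \in Phi -> 0 < ht b ->
  weyl_length form alpha (refl form b \o W s)%VF =
  (\sum_(x <- pos_roots) (ht (W (rev s) (refl form b x)) < 0)%R)%N.
Proof.
move=> bP hb; have [r rE] := refl_root_word bP hb.
have -> : (refl form b \o W s)%VF = W (r ++ s).
  by apply/lfunP => x; rewrite word_cat comp_lfunE rE.
rewrite weyl_length_ninv; apply: eq_bigr => x _; rewrite rev_cat word_cat.
by rewrite -{2}[x](word_revVK r) -rE reflK.
Qed.

(** If (x, b) were nonpositive, the reflection would add a nonnegative multiple of [b] to [x] and
    stay positive; so [root_sub] applies. *)
Lemma neg_refl_pair b x : b \in Phi -> 0 < ht b -> x \in Phi -> 0 < ht x ->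
  x != b -> ht (refl form b x) < 0 -> refl form b x = x - b.
Proof.
move=> bP hb xP hx xb hr; apply: root_sub => //.
rewrite ltNge; apply/negP => fxb; move: hr.
rewrite ltNge ltW // reflE htD htN htZ -mulNr ltr_wpDr //.
apply: mulr_ge0; last exact: ltW.
rewrite -mulNr; apply: mulr_ge0; first by lra.
by rewrite invr_ge0 ltW ?form_gt0 ?root_neq0.
Qed.

(** Both lengths count inversions. Positive roots that stay positive under the reflection cancel,
    [b] contributes [2 * c b - 1], and so does each [x] in [G] with [c x]. As [x -> b - x] permutes
    [G], the last sum may be symmetrized. *)
Lemma weyl_length_refl_diff s b (c := fun x => ht (W (rev s) x) < 0)
    (G := [seq x <- pos_roots | (x != b) && ~~ (0 < ht (refl form b x))]) :
  b \in Phi -> 0 < ht b ->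
  (weyl_length form alpha (W s))%:Z -
  (weyl_length form alpha (refl form b \o W s)%VF)%:Z =
  (2 * (c b)%:Z - 1) + \sum_(x <- G) ((c x)%:Z + (c (b - x))%:Z - 1).
Proof.
move=> bP hb; rewrite weyl_length_refl // sum_refl_roots // weyl_length_ninv.
have bpos : b \in pos_roots by rewrite mem_pos_roots bP.
have GP x : x \in G -> [/\ x \in Phi, 0 < ht x, x != b & refl form b x = x - b].
  rewrite mem_filter mem_pos_roots => /andP[/andP[xb hr] /andP[xP hx]].
  by split=> //; apply: neg_refl_pair => //; rewrite ht_root ?refl_root.
have GC x : x \in G -> b - x \in G.
  move=> xG; have [xP hx xb rx] := GP x xG.
  have bxP : b - x \in Phi by rewrite -opprB -rx opp_root ?refl_root.
  move: xG; rewrite !(mem_filter _ _ pos_roots) !mem_pos_roots bxP => /andP[/andP[_ hr] _].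
  rewrite -(opprB x) -rx htN oppr_gt0 ht_root ?refl_root // hr andbT linearN /=.
  rewrite reflK htN oppr_gt0 -leNgt ltW // andbT rx opprB.
  by rewrite -subr_eq0 addrAC subrr sub0r oppr_eq0 root_neq0.
have uG : uniq G by rewrite filter_uniq ?uniq_pos_roots.
have pG : perm_eq (map (fun x => b - x) G) G.
  by apply: perm_map_invol => // x _; rewrite subKr.
have -> : \sum_(x <- G) ((c x)%:Z + (c (b - x))%:Z - 1) = \sum_(x <- G) (2 * (c x)%:Z - 1).
  rewrite !sumrB big_split /=; congr (_ - _).
  rewrite -[X in _ + X](big_map (fun x => b - x) xpredT (fun x => (c x)%:Z)).
  by rewrite (perm_big _ pG) -mulr_sumr mulr_natl mulr2n.
have cb : ht (W (rev s) b) < 0 = c b by [].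
rewrite /ninv !(big_morph Posz PoszD (erefl _)) -sumrB.
rewrite (bigD1_seq b) ?uniq_pos_roots //= refl_self htN oppr_gt0 [ht b < 0]ltNge ltW //=.
congr (_ + _).
  rewrite -[0 < ht _]negbK -ht_root ?word_root // -/(c b).
  by case: (c b).
rewrite [RHS]big_filter [RHS]big_mkcond [LHS]big_mkcond /=.
rewrite big_seq [RHS]big_seq; apply: eq_bigr => x.
rewrite mem_pos_roots => /andP[xP hx]; case: eqP => //= _.
rewrite -/(c x); case: ifP => _ //=; first by rewrite subrr.
rewrite -[0 < ht _]negbK -ht_root ?word_root // -/(c x).
by case: (c x).
Qed.

(** The images of [x] and [b - x] under the inverse of [W s] add up to that of [b]. If the latter is
    negative, every term over [G] is nonnegative and vanishes unless both are inversions, so the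
    difference of lengths is 1 exactly when no decomposition exists. If it is positive, no term
    exceeds 0 and the difference is negative. *)
Lemma bruhat_inversionE s b : bruhat_inversion form alpha Phi (W s) b <->
  inversion alpha Phi (W s) b /\
  ~ exists g d, [/\ inversion alpha Phi (W s) g, inversion alpha Phi (W s) d & b = g + d].
Proof.
rewrite /bruhat_inversion.
case: (pselect (pos_root alpha Phi b)) => [/[dup] bpos /pos_rootE[bP hb]|nb]; last first.
  by split=> [[]|[[]]].
pose c x := ht (W (rev s) x) < 0.
pose G := [seq x <- pos_roots | (x != b) && ~~ (0 < ht (refl form b x))].
have diff : (weyl_length form alpha (W s))%:Z -
    (weyl_length form alpha (refl form b \o W s)%VF)%:Z =
  (2 * (c b)%:Z - 1) + \sum_(x <- G) ((c x)%:Z + (c (b - x))%:Z - 1).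
  exact: weyl_length_refl_diff.
have invE : inversion alpha Phi (W s) b <-> c b.
  by rewrite inversionE; split=> [[]|].
have GP x : x \in G -> [/\ x \in Phi, 0 < ht x, b - x \in Phi & 0 < ht (b - x)].
  rewrite mem_filter mem_pos_roots => /andP[/andP[xb hr] /andP[xP hx]].
  have hr' : ht (refl form b x) < 0 by rewrite ht_root ?refl_root.
  have rx := neg_refl_pair bP hb xP hx xb hr'.
  rewrite -(opprB x) -rx htN oppr_gt0 hr'; split=> //.
  by rewrite opp_root ?refl_root.
have cxy x : ht (W (rev s) b) = ht (W (rev s) x) + ht (W (rev s) (b - x)).
  by rewrite -htD -linearD /= addrC subrK.
have nc x : x \in Phi -> ~~ c x -> 0 < ht (W (rev s) x).
  by move=> xP; rewrite /c ht_root ?word_root // negbK.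
split=> [[_ len]|[/invE cb nsum]].
  have D1 : (2 * (c b)%:Z - 1) + \sum_(x <- G) ((c x)%:Z + (c (b - x))%:Z - 1) = 1.
    by rewrite -diff len -addn1 PoszD addrC addKr.
  have cb : c b.
    apply/negPn/negP => ncb; move: D1; rewrite (negPf ncb) mulr0 sub0r => /eqP.
    rewrite addrC subr_eq => /eqP D2.
    suff : \sum_(x <- G) ((c x)%:Z + (c (b - x))%:Z - 1) <= 0 by rewrite D2.
    rewrite big_seq sumr_le0 // => x /GP[xP hx bxP hbx].
    have := nc b bP ncb; rewrite (cxy x) => h.
    by rewrite /c; case: ltP => h1; case: ltP => h2 //; exfalso; lra.
  split=> [|[g [d [/inversionE[gP hg cg] /inversionE[dP hd cd] bE]]]].
    exact/invE.
  have /eqP S0 : \sum_(x <- G) ((c x)%:Z + (c (b - x))%:Z - 1) = 0.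
    have e : 2 * (true : nat)%:Z - 1 = 1 by [].
    by move: D1; rewrite cb e => /(canRL (addKr _)); rewrite addNr.
  have e0 x : x \in G -> 0 <= (c x)%:Z + (c (b - x))%:Z - 1.
    move=> /GP[xP hx bxP hbx]; have := cb; rewrite {1}/c (cxy x) => h.
    by rewrite /c; case: ltP => h1; case: ltP => h2 //; exfalso; lra.
  move: S0; rewrite big_seq psumr_eq0 // => /allP/(_ g).
  have bgd : b - g = d by rewrite bE addrC addKr.
  have gG : g \in G.
    have gb : g != b.
      by apply: contraTneq hd => gb; rewrite -bgd gb subrr ht0 ltxx.
    rewrite mem_filter mem_pos_roots gP hg gb -ht_root ?refl_root // !andbT /=.
    (* With n the common norm, n = (b, b) = 2n + 2(g, d), hence (g, b) = n/2. *)
    have fgb : 0 < form g b.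
      have [u _] : exists u : I, true.
        case: (pickP I) => [u _|nI]; first by exists u.
        by have := root_neq0 bP; rewrite [b]ct_sum big_pred0 ?eqxx.
      have ng := root_norm u gP; have nd := root_norm u dP.
      have := form_gt0 form (root_neq0 gP).
      have := root_norm u bP; rewrite bE linearDr !linearDl /=.
      rewrite (dotC form d g) ng nd; lra.
    by rewrite root_sub // -opprB bgd htN oppr_lt0.
  by move=> /(_ gG); rewrite gG bgd /c cg cd.
split=> //; apply/eqP; rewrite -eqz_nat -addn1 PoszD addrC -subr_eq diff cb mulr1.
rewrite big_seq big1 // => x xG; have [xP hx bxP hbx] := GP x xG.
have := cb; rewrite {1}/c (cxy x) => cxx.
have : ~~ (c x && c (b - x)).
  apply/negP => /andP[cx cbx]; apply: nsum; exists x, (b - x).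
  by split; [exact/inversionE|exact/inversionE|rewrite addrC subrK].
by rewrite /c; case: ltP => h1; case: ltP => h2 //= _; exfalso; lra.
Qed.

End Roots.

(** * Sums, summands and kernels of representations *)

Section VectorAux.

Variable k : fieldType.

Lemma dim0P (V : vectType k) : \dim {:V} = 0%N <-> forall x : V, x = 0.
Proof.
split=> [/eqP|V0].
  by rewrite dimv_eq0 => /eqP V0 x; apply/eqP; rewrite -memv0 -V0 memvf.
by apply/eqP; rewrite dimv_eq0 -subv0; apply/subvP => x _; rewrite (V0 x) mem0v.
Qed.

(** Coordinates padded with zeros: this puts all the spaces of a representation into one ambient
    space. *)
Lemma ex_embed (V : vectType k) n : (\dim {:V} <= n)%N ->
  {e : 'Hom(V, 'rV[k]_n) & {r : 'Hom('rV[k]_n, V) | cancel e r}}.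
Proof.
move=> Vn; pose d := \dim {:V}; pose b := vbasis {:V}.
have [|e eE] := @ex_lfun k V 'rV[k]_n (fun x => passmx.rVof b x *m pid_mx d).
  by move=> c x y; rewrite passmx.rVof_linear mulmxDl scalemxAl.
have [|r rE] := @ex_lfun k 'rV[k]_n V (fun x => passmx.vecof b (x *m pid_mx d)).
  by move=> c x y; rewrite mulmxDl -scalemxAl passmx.vecof_linear.
exists e, r => x; rewrite rE eE -mulmxA mul_pid_mx minnn (minn_idPr Vn).
by rewrite pid_mx_1 mulmx1 passmx.rVofK ?vbasisP.
Qed.

End VectorAux.

Section Reps.

Variables (k : fieldType) (Q : quiver).
Implicit Types M N L : rep k Q.
Notation src := (@source Q).
Notation tgt := (@target Q).

Lemma rep_homE M N (f : forall i, 'Hom(M i, N i)) :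
  rep_hom f <-> forall a x, f (tgt a) (rep_map M a x) = rep_map N a (f (src a) x).
Proof.
split=> [fh a x|fh a].
  by have := congr1 (fun g : 'Hom(_, _) => g x) (fh a); rewrite !comp_lfunE.
by apply/lfunP => x; rewrite !comp_lfunE.
Qed.

Lemma rep_hom_comp L M N (f : forall i, 'Hom(M i, N i)) (g : forall i, 'Hom(L i, M i)) :
  rep_hom f -> rep_hom g -> rep_hom (fun i => (f i \o g i)%VF).
Proof.
move=> /rep_homE fh /rep_homE gh; apply/rep_homE => a x.
by rewrite !comp_lfunE gh fh.
Qed.

Lemma rep_isoI M N (f : forall i, 'Hom(M i, N i)) (g : forall i, 'Hom(N i, M i)) :
  rep_hom f -> (forall i, cancel (f i) (g i)) -> (forall i, cancel (g i) (f i)) ->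
  rep_iso M N.
Proof.
move=> fh fK gK; exists f, g; split=> // [|i|i].
- move/rep_homE: fh => fh; apply/rep_homE => a x.
  by rewrite -{1}[x]gK -fh fK.
- by apply/lfunP => x; rewrite comp_lfunE id_lfunE fK.
- by apply/lfunP => x; rewrite comp_lfunE id_lfunE gK.
Qed.

Lemma rep_isoE M N : rep_iso M N ->
  exists (f : forall i, 'Hom(M i, N i)) (g : forall i, 'Hom(N i, M i)),
  [/\ rep_hom f, rep_hom g, forall i, cancel (f i) (g i) & forall i, cancel (g i) (f i)].
Proof.
move=> [f [g [fh gh fK gK]]]; exists f, g; split=> // i x.
  by rewrite -comp_lfunE fK id_lfunE.
by rewrite -comp_lfunE gK id_lfunE.
Qed.

Lemma rep_iso_refl M : rep_iso M M.
Proof.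
apply: (@rep_isoI M M (fun=> \1%VF) (fun=> \1%VF)) => [|i x|i x].
- by apply/rep_homE => a x; rewrite !id_lfunE.
- by rewrite !id_lfunE.
- by rewrite !id_lfunE.
Qed.

Lemma rep_iso_sym M N : rep_iso M N -> rep_iso N M.
Proof.
by move=> /rep_isoE[f [g [fh gh fK gK]]]; apply: rep_isoI gh gK fK.
Qed.

Lemma rep_iso_trans L M N : rep_iso L M -> rep_iso M N -> rep_iso L N.
Proof.
move=> /rep_isoE[f [g [fh gh fK gK]]] /rep_isoE[f' [g' [fh' gh' fK' gK']]].
apply: (@rep_isoI _ _ _ (fun i => (g i \o g' i)%VF) (rep_hom_comp fh' fh)) => i x.
  by rewrite !comp_lfunE fK' fK.
by rewrite !comp_lfunE gK gK'.
Qed.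

Lemma rep_iso_inj M N (f : forall i, 'Hom(M i, N i)) : rep_hom f ->
  (forall i, injective (f i)) -> (forall i, \dim {: M i} = \dim {: N i}) ->
  rep_iso M N.
Proof.
move=> fh fI MN; have fker i : lker (f i) == 0%VS by apply/lker0P/fI.
apply: (rep_isoI (g := fun i => (f i)^-1%VF) fh) => i x.
  exact: lker0_lfunK.
apply: limg_lfunVK; suff -> : limg (f i) = fullv by rewrite memvf.
apply/eqP; rewrite eqEdim subvf limg_dim_eq /= ?MN //.

by rewrite (eqP (fker i)) capv0.
Qed.

Lemma rep_iso_dim M N : rep_iso M N -> forall i, \dim {: M i} = \dim {: N i}.
Proof.
have le_dim L1 L2 : rep_iso L1 L2 -> forall i, (\dim {: L1 i} <= \dim {: L2 i})%N.
  move=> /rep_isoE[f [g [_ _ fK _]]] i.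
  have /eqP kf : lker (f i) == 0%VS by apply/lker0P/can_inj/fK.
  by rewrite -(@limg_dim_eq _ _ _ (f i)) ?dimvS ?subvf // kf capv0.
move=> MN i; apply/eqP; rewrite eqn_leq !le_dim //.
exact: rep_iso_sym.
Qed.

(* Idempotent endomorphisms are the projections onto direct summands. *)
Definition connected_rep M : Prop :=
  ~ rep_is0 M /\
  forall e : (forall i, 'End(M i)), rep_hom (M := M) (N := M) e ->
    (forall i x, e i (e i x) = e i x) ->
    (forall i x, e i x = 0) \/ (forall i x, e i x = x).

Lemma rep_sum_mapE M N a u :
  rep_map (rep_sum M N) a u = (rep_map M a u.1, rep_map N a u.2).
Proof. by rewrite /= lfunE. Qed.

Definition proj1_rep M N i : 'Hom(rep_sum M N i, M i) := linfun fst.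
Definition proj2_rep M N i : 'Hom(rep_sum M N i, N i) := linfun snd.

Lemma proj1_repE M N i (u : rep_sum M N i) : proj1_rep M N i u = u.1.
Proof. by rewrite lfunE. Qed.
Lemma proj2_repE M N i (u : rep_sum M N i) : proj2_rep M N i u = u.2.
Proof. by rewrite lfunE. Qed.

Lemma proj1_rep_hom M N : rep_hom (@proj1_rep M N).
Proof. by apply/rep_homE => a u; rewrite !proj1_repE rep_sum_mapE. Qed.
Lemma proj2_rep_hom M N : rep_hom (@proj2_rep M N).
Proof. by apply/rep_homE => a u; rewrite !proj2_repE rep_sum_mapE. Qed.

Lemma ex_pair_rep L M N (f : forall i, 'Hom(L i, M i)) (g : forall i, 'Hom(L i, N i)) :
  {h : forall i, 'Hom(L i, rep_sum M N i) | forall i x, h i x = (f i x, g i x)}.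
Proof.
have lin i : linear (fun x => (f i x, g i x) : rep_sum M N i).
  by move=> c x y; rewrite !linearP.
by exists (fun i => sval (ex_lfun (lin i))) => i x; case: ex_lfun.
Qed.

Lemma pair_rep_hom L M N (f : forall i, 'Hom(L i, M i)) (g : forall i, 'Hom(L i, N i))
    (h : forall i, 'Hom(L i, rep_sum M N i)) :
  rep_hom f -> rep_hom g -> (forall i x, h i x = (f i x, g i x)) -> rep_hom h.
Proof.
move=> /rep_homE fh /rep_homE gh hE; apply/rep_homE => a x.
by rewrite !hE rep_sum_mapE fh gh.
Qed.

Lemma rep_sum_iso M N M' N' : rep_iso M M' -> rep_iso N N' ->
  rep_iso (rep_sum M N) (rep_sum M' N').
Proof.
move=> /rep_isoE[f [g [fh gh fK gK]]] /rep_isoE[f' [g' [fh' gh' fK' gK']]].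
have [h hE] := ex_pair_rep (fun i => (f i \o proj1_rep M N i)%VF)
  (fun i => (f' i \o proj2_rep M N i)%VF).
have [h' h'E] := ex_pair_rep (fun i => (g i \o proj1_rep M' N' i)%VF)
  (fun i => (g' i \o proj2_rep M' N' i)%VF).
apply: (rep_isoI (f := h) (g := h')) => [|i [x y]|i [x y]].
- by apply: pair_rep_hom hE; apply: rep_hom_comp => //;
    [exact: proj1_rep_hom|exact: proj2_rep_hom].
- by rewrite h'E hE !comp_lfunE !proj1_repE !proj2_repE /= fK fK'.
- by rewrite hE h'E !comp_lfunE !proj1_repE !proj2_repE /= gK gK'.
Qed.

Lemma dim_rep_sum M N i : \dim {: rep_sum M N i} = (\dim {: M i} + \dim {: N i})%N.
Proof. by rewrite !dimvf. Qed.

Lemma dim_rep0 i : \dim {: rep0 k Q i} = 0%N.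
Proof. by rewrite dimvf /= dim_matrix. Qed.

Lemma rep_sum0l M : rep_iso (rep_sum (rep0 k Q) M) M.
Proof.
apply: (rep_iso_inj (@proj2_rep_hom (rep0 k Q) M)) => i.
  move=> [x1 y1] [x2 y2]; rewrite !proj2_repE /= => ->.
  by congr pair; rewrite [x1]thinmx0 [x2]thinmx0.
by rewrite dim_rep_sum dim_rep0.
Qed.

Lemma rep_sum0r M : rep_iso (rep_sum M (rep0 k Q)) M.
Proof.
apply: (rep_iso_inj (@proj1_rep_hom M (rep0 k Q))) => i.
  move=> [x1 y1] [x2 y2]; rewrite !proj1_repE /= => ->.
  by congr pair; rewrite [y1]thinmx0 [y2]thinmx0.
by rewrite dim_rep_sum dim_rep0 addn0.
Qed.

Lemma rep_sumA L M N :
  rep_iso (rep_sum (rep_sum L M) N) (rep_sum L (rep_sum M N)).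
Proof.
pose p1 := rep_hom_comp (@proj1_rep_hom L M) (@proj1_rep_hom (rep_sum L M) N).
pose p2 := rep_hom_comp (@proj2_rep_hom L M) (@proj1_rep_hom (rep_sum L M) N).
have [h hE] := ex_pair_rep (fun i => (proj2_rep L M i \o proj1_rep (rep_sum L M) N i)%VF)
  (proj2_rep (rep_sum L M) N).
have hh := pair_rep_hom p2 (@proj2_rep_hom (rep_sum L M) N) hE.
have [h' h'E] := ex_pair_rep (fun i => (proj1_rep L M i \o proj1_rep (rep_sum L M) N i)%VF) h.
apply: (rep_iso_inj (pair_rep_hom p1 hh h'E)) => i.
  move=> [[x1 y1] z1] [[x2 y2] z2]; rewrite !h'E !hE !comp_lfunE.
  by rewrite !proj1_repE !proj2_repE => -[/= -> -> ->].
by rewrite !dim_rep_sum addnA.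
Qed.

Lemma rep_bigsum_cat (s t : seq (rep k Q)) :
  rep_iso (rep_bigsum (s ++ t)) (rep_sum (rep_bigsum s) (rep_bigsum t)).
Proof.
elim: s => [|M s IHs] /=; first exact/rep_iso_sym/rep_sum0l.
apply: rep_iso_trans (rep_sum_iso (rep_iso_refl M) IHs) _.
exact/rep_iso_sym/rep_sumA.
Qed.

Lemma vsproj_lfunE (V : vectType k) (U : {vspace V}) x :
  linfun (vsproj U) x = vsproj U x.
Proof. by rewrite lfunE. Qed.

Lemma vsval_lfunE (V : vectType k) (U : {vspace V}) (x : subvs_of U) :
  linfun vsval x = vsval x.
Proof. by rewrite lfunE. Qed.

Lemma rep_of_sub_mapE M (L : subrep M) a x :
  vsval (rep_map (rep_of_sub L) a x) = rep_map M a (vsval x).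
Proof.
rewrite /= !comp_lfunE vsproj_lfunE vsval_lfunE vsprojK //.
by rewrite (subvP (sub_stable L a)) ?memv_img ?subvsP.
Qed.

Definition incl_rep M (L : subrep M) i : 'Hom(rep_of_sub L i, M i) := linfun vsval.

Lemma incl_repE M (L : subrep M) i x : incl_rep L i x = vsval x.
Proof. exact: vsval_lfunE. Qed.

Lemma incl_rep_hom M (L : subrep M) : rep_hom (@incl_rep M L).
Proof. by apply/rep_homE => a x; rewrite !incl_repE rep_of_sub_mapE. Qed.

Lemma corestr_rep_hom M N (L : subrep N) (f : forall i, 'Hom(M i, N i)) :
  rep_hom f -> (forall i x, f i x \in L i) ->
  {g : forall i, 'Hom(M i, rep_of_sub L i) |
    rep_hom g /\ forall i x, vsval (g i x) = f i x}.
Proof.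
move=> /rep_homE fh fL.
pose g i : 'Hom(M i, rep_of_sub L i) := (linfun (vsproj (L i)) \o f i)%VF.
have gE i x : vsval (g i x) = f i x by rewrite comp_lfunE vsproj_lfunE vsprojK ?fL.
exists g; split=> //; apply/rep_homE => a x; apply: subvs_inj.
by rewrite rep_of_sub_mapE !gE fh.
Qed.

Definition subrep_of M (U : forall i, {vspace M i})
    (h : forall a x, x \in U (src a) -> rep_map M a x \in U (tgt a)) : subrep M.
Proof.
exists U => a; apply/subvP => _ /memv_imgP[x xU ->]; exact: h.
Defined.

Lemma connected_indecomposable M : connected_rep M -> indecomposable M.
Proof.
move=> [M0 idemM]; split=> // A B /rep_isoE[f [g [fh gh fK gK]]].
have lin i : linear (fun x : rep_sum A B i => ((x.1, 0) : rep_sum A B i)).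
  by move=> c x y; congr pair => /=; rewrite scaler0 addr0.
pose p i := sval (ex_lfun (lin i)).
have pE i x : p i x = (x.1, 0) by rewrite /p; case: ex_lfun.
have ph : rep_hom p.
  by apply/rep_homE => a x; rewrite !pE !rep_sum_mapE /= linear0.
have [||e0|e1] := idemM (fun i => (g i \o (p i \o f i))%VF).
- exact/(rep_hom_comp gh)/(rep_hom_comp ph).
- by move=> i x; rewrite !comp_lfunE gK !pE.
- left=> i; apply/dim0P => x; have := e0 i (g i (x, 0)).
  rewrite !comp_lfunE gK pE => /(congr1 (f i)).
  by rewrite gK linear0 => -[].
right=> i; apply/dim0P => x; have := e1 i (g i (0, x)).
rewrite !comp_lfunE gK pE => /(congr1 (f i)).
by rewrite !gK => -[].
Qed.

(** An idempotent splits [M] into its image and its kernel, by [x -> (e x, x - e x)]. *)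
Lemma indecomposable_connected M : indecomposable M -> connected_rep M.
Proof.
move=> [M0 splitM]; split=> // e /[dup] eh /rep_homE eE eK.
have imE i x : (x \in limg (e i)) = (e i x == x).
  apply/memv_imgP/eqP => [[y _ ->]|<-]; first exact: eK.
  by exists x; rewrite ?memvf.
have [A AE] : {A : subrep M | forall i, A i = limg (e i)}.
  unshelve eexists (@subrep_of M (fun i => limg (e i)) _) => //.
  by move=> a x; rewrite !imE eE => /eqP ->.
have [B BE] : {B : subrep M | forall i, B i = lker (e i)}.
  unshelve eexists (@subrep_of M (fun i => lker (e i)) _) => //.
  by move=> a x; rewrite !memv_ker eE => /eqP ->; rewrite linear0.
pose q i := (\1 - e i)%VF : 'End(M i).
have qE i x : q i x = x - e i x by rewrite add_lfunE opp_lfunE id_lfunE.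
have qh : rep_hom (M := M) (N := M) q.
  by apply/rep_homE => a x; rewrite !qE linearB /= eE.
have eA i x : e i x \in A i by rewrite AE memv_img ?memvf.
have [f [fh fE]] := @corestr_rep_hom M M A e eh eA.
have qB i x : q i x \in B i by rewrite BE memv_ker qE linearB /= eK subrr.
have [g [gh gE]] := @corestr_rep_hom M M B q qh qB.
have [h hE] := ex_pair_rep f g.
have iso : rep_iso M (rep_sum (rep_of_sub A) (rep_of_sub B)).
  have lin i : linear (fun u : rep_sum (rep_of_sub A) (rep_of_sub B) i => vsval u.1 + vsval u.2).
    by move=> c x y; rewrite /= scalerDr addrACA.
  apply: (rep_isoI (f := h) (g := fun i => sval (ex_lfun (lin i)))).
  - exact: pair_rep_hom hE.
  - by move=> i x; case: ex_lfun => /= r ->; rewrite hE /= fE gE qE addrC subrK.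
  - move=> i [x y]; case: ex_lfun => /= r ->; rewrite hE /=.
    have xA : e i (vsval x) = vsval x by apply/eqP; rewrite -imE -AE subvsP.
    have yB : e i (vsval y) = 0 by apply/eqP; rewrite -memv_ker -BE subvsP.
    congr pair; apply: subvs_inj; first by rewrite fE linearD /= xA yB addr0.
    by rewrite gE qE linearD /= xA yB addr0 addrAC subrr add0r.
case: (splitM _ _ iso) => [A0|B0]; [left|right] => i x.
  have /dim0P/(_ (f i x)) := A0 i; move/(congr1 vsval); rewrite fE.
  by rewrite linear0.
have /dim0P/(_ (g i x)) := B0 i; move/(congr1 vsval); rewrite gE qE.
by rewrite linear0 => /eqP; rewrite subr_eq0 => /eqP.
Qed.

End Reps.

(** * Decomposition into indecomposables, kernels and dimension vectors *)

Section Decomposition.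

Variables (k : fieldType) (Q : quiver).
Implicit Types M N L : rep k Q.
Notation src := (@source Q).
Notation tgt := (@target Q).

Fixpoint all_reps (P : rep k Q -> Prop) (s : seq (rep k Q)) : Prop :=
  if s is N :: s' then P N /\ all_reps P s' else True.

Lemma all_reps_cat P s t : all_reps P s -> all_reps P t -> all_reps P (s ++ t).
Proof. by elim: s => //= N s IHs [PN Ps] Pt; split; [|exact: IHs]. Qed.

Lemma all_reps_nth P s m : all_reps P s -> (m < size s)%N ->
  P (nth (rep0 k Q) s m).
Proof. by elim: s m => //= N s IHs [|m] [PN Ps] // ms; apply: IHs. Qed.

Lemma all_reps_impl (P P' : rep k Q -> Prop) s :
  (forall N, P N -> P' N) -> all_reps P s -> all_reps P' s.
Proof. by move=> PP'; elim: s => //= N s IHs [/PP' PN /IHs]. Qed.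

Lemma add_dimvecE (R : realType) (V : vectType R) (alpha : vertex Q -> V)
    (S : V -> Prop) M :
  add_dimvec alpha S M <-> exists2 s,
    all_reps (fun N => indecomposable N /\ S (dimvec alpha N)) s &
    rep_iso M (rep_bigsum s).
Proof.
split=> [[n [N [NS iso]]]|[s sP iso]].
  exists [seq N m | m <- enum 'I_n] => //.
  by elim: (enum _) => //= m s IHs.
exists (size s), (fun m => nth (rep0 k Q) s m); split=> [m|].
  exact: all_reps_nth sP (ltn_ord m).
rewrite (map_comp (nth (rep0 k Q) s) val) val_enum_ord.
by rewrite map_nth_iota0 // take_size.
Qed.

(** Existence only, by induction on the total dimension. *)
Lemma krull_schmidt M :
  exists2 s, all_reps (@indecomposable k Q) s & rep_iso M (rep_bigsum s).
Proof.
have [n] := ubnP (\sum_i \dim {: M i})%N; elim: n M => // n IHn M Mn.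
case: (pselect (rep_is0 M)) => [M0|M0].
  exists [::] => //=; apply: (rep_iso_inj (f := fun=> 0)) => [|i x y _|i].
  - by apply/rep_homE => a x; rewrite !zero_lfunE ?linear0.
  - by have /dim0P M0i := M0 i; rewrite (M0i x) (M0i y).
  - by rewrite M0 dim_rep0.
case: (pselect (indecomposable M)) => [indM|nindM].
  by exists [:: M] => //=; apply/rep_iso_sym/rep_sum0r.
have [A [B [iso A0 B0]]] : exists A B : rep k Q,
    [/\ rep_iso M (rep_sum A B), ~ rep_is0 A & ~ rep_is0 B].
  apply: contrapT => nAB; apply: nindM; split=> // A B iso.
  apply: contrapT => /not_orP[A0 B0]; apply: nAB; by exists A, B.
have pos0 N : ~ rep_is0 N -> (0 < \sum_i \dim {: N i})%N.
  move=> N0; rewrite lt0n; apply/negP => /eqP sN; apply: N0 => i.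
  by move/eqP: sN; rewrite sum_nat_eq0 => /forallP/(_ i)/eqP.
have dMAB : (\sum_i \dim {: M i} = \sum_i \dim {: A i} + \sum_i \dim {: B i})%N.
  rewrite -big_split /=; apply: eq_bigr => i _.
  by rewrite (rep_iso_dim iso) dim_rep_sum.
have [|sA sAi isoA] := IHn A.
  by rewrite -ltnS; apply: leq_trans Mn; rewrite ltnS dMAB -[X in (X < _)%N]addn0 ltn_add2l pos0.
have [|sB sBi isoB] := IHn B.
  by rewrite -ltnS; apply: leq_trans Mn; rewrite ltnS dMAB -[X in (X < _)%N]add0n ltn_add2r pos0.
exists (sA ++ sB); first exact: all_reps_cat.
apply: rep_iso_trans iso _.
apply: rep_iso_trans (rep_sum_iso isoA isoB) _.
exact/rep_iso_sym/rep_bigsum_cat.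
Qed.

(** The coordinate projections separate points; this is the form in which [closed_cogenerated] uses
    an embedding into a sum. *)
Lemma bigsum_separated P s i (x : rep_bigsum s i) : all_reps P s -> x <> 0 ->
  exists N (f : forall i, 'Hom(rep_bigsum s i, N i)),
    [/\ P N, rep_hom f & f i x <> 0].
Proof.
elim: s x => [|N s IHs] x.
  by move=> _ x0; case: x0; exact: ((dim0P _).1 (dim_rep0 k i) x).
case: x => x1 x2 /= [PN Ps] x0.
case: (pselect (x1 = 0)) => [x10|x10]; last first.
  exists N, (@proj1_rep k Q N (rep_bigsum s)); split=> //.
    exact: proj1_rep_hom.
  by rewrite proj1_repE.
have [|N' [f [PN' fh fx]]] := IHs x2 Ps.
  by move=> x20; apply: x0; rewrite x10 x20.
exists N', (fun i => (f i \o proj2_rep N (rep_bigsum s) i)%VF); split=> //.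
  exact: rep_hom_comp fh (@proj2_rep_hom _ _ _ _).
by rewrite comp_lfunE proj2_repE.
Qed.

Lemma bigsum_summand P s : all_reps P s ->
  all_reps (fun N => P N /\ exists f : forall i, 'Hom(N i, rep_bigsum s i),
    rep_hom f /\ forall i, injective (f i)) s.
Proof.
elim: s => //= N s IHs [PN Ps]; split.
  split=> //; have lin i : linear (fun x : N i => ((x, 0) : rep_sum N (rep_bigsum s) i)).
    by move=> c x y; congr pair => /=; rewrite scaler0 addr0.
  exists (fun i => sval (ex_lfun (lin i))); split.
    apply/rep_homE => a x; case: ex_lfun => f fE; case: ex_lfun => g gE /=.
    by rewrite fE gE rep_sum_mapE /= linear0.
  by move=> i x y; case: ex_lfun => f fE /=; rewrite !fE => -[].
apply: all_reps_impl (IHs Ps) => L [PL [f [/rep_homE fh fI]]]; split=> //.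
have lin i : linear (fun x : L i => ((0, f i x) : rep_sum N (rep_bigsum s) i)).
  by move=> c x y; congr pair => /=; rewrite ?scaler0 ?addr0 ?linearP.
exists (fun i => sval (ex_lfun (lin i))); split.
  apply/rep_homE => a x; case: ex_lfun => g gE; case: ex_lfun => g' gE' /=.
  by rewrite gE gE' rep_sum_mapE /= linear0 fh.
by move=> i x y; case: ex_lfun => g gE /=; rewrite !gE => -[/fI].
Qed.

(** Injectivity of the induced map replaces any mention of the image: membership of the quotient in
    the class will follow from closure under subobjects. *)
Lemma ex_kernel_rep M N (f : forall i, 'Hom(M i, N i)) : rep_hom f ->
  exists2 L : subrep M, (forall i, L i = lker (f i)) &
    exists2 g : (forall i, 'Hom(rep_quot L i, N i)), rep_hom g &
      forall i, injective (g i).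
Proof.
move=> /rep_homE fh.
have st a x : x \in lker (f (src a)) -> rep_map M a x \in lker (f (tgt a)).
  by rewrite !memv_ker fh => /eqP ->; rewrite linear0.
exists (@subrep_of k Q M (fun i => lker (f i)) st) => //.
pose L := @subrep_of k Q M (fun i => lker (f i)) st.
pose inc i : 'Hom(rep_quot L i, M i) := linfun vsval.
have incE i x : inc i x = vsval x by exact: vsval_lfunE.
exists (fun i => (f i \o inc i)%VF).
  apply/rep_homE => a x.
  rewrite (comp_lfunE _ (inc (tgt a))) (comp_lfunE _ (inc (src a))) !incE.
  rewrite (comp_lfunE _ (inc (src a))) incE.
  rewrite (comp_lfunE (quot_proj _)) quot_projE linearB /= fh.
  have /eqP -> : f (tgt a) (projv (lker (f (tgt a)))
      (rep_map M a (vsval x))) == 0 by rewrite -memv_ker memv_proj.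
  by rewrite subr0.
move=> i x y; rewrite !(comp_lfunE _ (inc i)) !incE => /eqP.
rewrite -subr_eq0 -linearB -memv_ker => xy; apply: subvs_inj.
apply/eqP; rewrite -subr_eq0 -memv0 -(capv_compl (L i)) memv_cap xy /=.
by rewrite memvB ?subvsP.
Qed.

Lemma dimvec_iso (R : realType) (V : vectType R) (alpha : vertex Q -> V) M N :
  rep_iso M N -> dimvec alpha M = dimvec alpha N.
Proof. by move=> MN; apply: eq_bigr => i _; rewrite (rep_iso_dim MN). Qed.

Lemma dimvec_sum (R : realType) (V : vectType R) (alpha : vertex Q -> V) M N :
  dimvec alpha (rep_sum M N) = dimvec alpha M + dimvec alpha N.
Proof.
rewrite -big_split /=; apply: eq_bigr => i _.
by rewrite (dim_rep_sum M N) natrD scalerDl.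
Qed.

Lemma dimvec_rep0 (R : realType) (V : vectType R) (alpha : vertex Q -> V) M :
  rep_is0 M -> dimvec alpha M = 0.
Proof. by move=> M0; apply: big1 => i _; rewrite M0 scale0r. Qed.

Lemma dimvec_bigsum (R : realType) (V : vectType R) (alpha : vertex Q -> V)
    (s : seq (rep k Q)) :
  dimvec alpha (rep_bigsum s) = \sum_(N <- s) dimvec alpha N.
Proof.
elim: s => [|N s IHs]; last by rewrite big_cons -IHs /= dimvec_sum.
by rewrite big_nil dimvec_rep0 // => i; rewrite dim_rep0.
Qed.

Lemma dimvec_sub_quot (R : realType) (V : vectType R) (alpha : vertex Q -> V) M
    (L : subrep M) :
  dimvec alpha M = dimvec alpha (rep_of_sub L) + dimvec alpha (rep_quot L).
Proof.
rewrite -big_split /=; apply: eq_bigr => i _; rewrite -scalerDl -natrD.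
rewrite 2![\dim {: subvs_of _}]dimvf; congr (_%:R *: _).
rewrite -[LHS]/(\dim {: M i}) -[dim (subvs_of (L i)^C)]/(\dim (L i)^C).
by rewrite dimv_compl -[dim _]/(\dim (L i)) subnKC // dimvS ?subvf.
Qed.

End Decomposition.

(** * Translation between the two encodings of representations *)

Section Models.

Variables (k : fieldType) (Q : quiver).
Implicit Types M N L : rep k Q.
Notation src := (@source Q).
Notation tgt := (@target Q).
Notation erep := (erep k (vertex Q) (arrow Q)).

(** [E] is a copy of [M] inside one ambient space. The retractions [r] are defined on the whole of
    it, but are inverse to [e] only on the [E i]. *)
Definition models M (E : erep) (e : forall i, 'Hom(M i, amb E))
    (r : forall i, 'Hom(amb E, M i)) : Prop :=
  [/\ forall i, cancel (e i) (r i),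
      forall i y, y \in E i -> e i (r i y) = y,
      forall i x, e i x \in E i
    & forall a x, emap E a (e (src a) x) = e (tgt a) (rep_map M a x)].

Lemma ex_embeddings M : exists n (e : forall i, 'Hom(M i, 'rV[k]_n))
  (r : forall i, 'Hom('rV[k]_n, M i)), forall i, cancel (e i) (r i).
Proof.
pose n := (\sum_i \dim {: M i})%N.
have Mn i : (\dim {: M i} <= n)%N by rewrite /n (bigD1 i) //= leq_addr.
exists n, (fun i => projT1 (ex_embed (Mn i))),
  (fun i => projT1 (projT2 (ex_embed (Mn i)))) => i.
by case: ex_embed => e [r].
Qed.

Lemma ex_model M : exists (E : erep) e r, @models M E e r.
Proof.
have [n [e [r eK]]] := ex_embeddings M.
exists (@Erep k (vertex Q) (arrow Q) 'rV[k]_n (fun i => limg (e i))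
  (fun a => (e (tgt a) \o (rep_map M a \o r (src a)))%VF)), e, r.
split=> //= [i y /memv_imgP[x _ ->]|i x|a x].
- by rewrite eK.
- by rewrite memv_img ?memvf.
- by rewrite !comp_lfunE eK.
Qed.

Lemma ex_modelled (E : erep) : estable src tgt E -> exists M e r, @models M E e r.
Proof.
move=> stE.
pose M := @Rep k Q (fun i => subvs_of (E i)) (fun a =>
  linfun (vsproj (E (tgt a))) \o emap E a \o linfun (vsval : subvs_of (E (src a)) -> _))%VF.
exists M, (fun i => linfun (vsval : subvs_of (E i) -> _)), (fun i => linfun (vsproj (E i))).
split=> [i x|i y yE|i x|a x].
- by rewrite !lfunE /= vsvalK.
- by rewrite !lfunE /= vsprojK.
- by rewrite lfunE subvsP.
- rewrite [in RHS]lfunE !comp_lfunE /= [linfun (vsproj _) _]lfunE.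
  by rewrite [in RHS]lfunE [in LHS]lfunE /= vsprojK // stE ?subvsP.
Qed.

Section OneModel.

Variables (M : rep k Q) (E : erep).
Variables (e : forall i, 'Hom(M i, amb E)) (r : forall i, 'Hom(amb E, M i)).
Hypothesis mM : models e r.

Lemma models_stable : estable src tgt E.
Proof.
by case: mM => _ rK eE em a x /rK <-; rewrite em.
Qed.

Lemma models_dim i : \dim (E i) = \dim {: M i}.
Proof.
case: mM => eK rK eE em; have -> : E i = limg (e i).
  apply/vspaceP => y; apply/idP/memv_imgP => [yE|[x _ ->]] //.
  by exists (r i y); rewrite ?memvf ?rK.
have /lker0P/eqP ke := can_inj (eK i).
by rewrite limg_dim_eq // ke capv0.
Qed.

Lemma models_dimvec (R : realType) (V : vectType R) (alpha : vertex Q -> V) :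
  edimvec alpha E = dimvec alpha M.
Proof. by apply: eq_bigr => i _; rewrite models_dim. Qed.

Lemma models_connected : connected_rep M <-> eindec src tgt E.
Proof.
case: mM => eK rK eE em.
have E0 : rep_is0 M <-> ~ exists i, E i <> 0%VS.
  split=> [M0 [i]|nE i].
    by apply; apply/eqP; rewrite -dimv_eq0 models_dim M0.
  rewrite -models_dim; apply/eqP; rewrite dimv_eq0; apply/eqP.
  by apply: contrapT => Ei; apply: nE; exists i.
split=> [[M0 idem]|[[i Ei] idem]].
  split; first by apply: contrapT => nE; apply/M0/E0.
  move=> g [gE gm] gK; have [||h0|h1] := idem (fun i => (r i \o (g i \o e i))%VF).
  - apply/rep_homE => a x; rewrite !comp_lfunE -em gm ?eE //.
    by rewrite -(rK _ _ (gE _ _ (eE _ x))) em !eK.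
  - by move=> i x; rewrite !comp_lfunE rK ?gE ?eE // gK ?eE.
  - left=> i y yE; have := h0 i (r i y); rewrite !comp_lfunE rK // => p0.
    by rewrite -[LHS](rK i) ?gE // p0 linear0.
  - right=> i y yE; have := h1 i (r i y); rewrite !comp_lfunE rK // => p0.
    by rewrite -[LHS](rK i) ?gE // p0 rK.
split; first by move/E0; apply; exists i.
move=> h /rep_homE hh hK; have [||g0|g1] := idem (fun i => (e i \o (h i \o r i))%VF).
- split=> [j y yE|a y yE]; first by rewrite !comp_lfunE.
  by rewrite !comp_lfunE em -hh -[in LHS](rK _ _ yE) em !eK.
- by move=> j y yE; rewrite !comp_lfunE eK hK.
- left=> j x; have := g0 j (e j x) (eE _ _); rewrite !comp_lfunE eK => p0.
  by rewrite -[LHS]eK p0 linear0.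
- right=> j x; have := g1 j (e j x) (eE _ _); rewrite !comp_lfunE eK => p0.
  by rewrite -[LHS]eK p0 eK.
Qed.

End OneModel.

Lemma models_hom M N (E F : erep) e r e' r' (h : forall i, 'Hom(M i, N i)) :
  @models M E e r -> @models N F e' r' -> rep_hom h ->
  ehom src tgt (M := E) (N := F) (fun i => (e' i \o (h i \o r i))%VF).
Proof.
move=> [eK rK eE em] [eK' rK' eE' em'] /rep_homE hh.
split=> [i x xE|a x xE]; rewrite !comp_lfunE ?eE' //.
by rewrite -[in LHS](rK _ _ xE) em eK hh em'.
Qed.

End Models.

(** * Euler form *)

Section EulerForm.

Variables (k : fieldType) (Q : quiver).
Implicit Types M N : rep k Q.
Notation src := (@source Q).
Notation tgt := (@target Q).

(* Hom(M, N) is the kernel of (+)_i Hom(M_i, N_i) -> (+)_a Hom(M_(src a),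
   N_(tgt a)). *)
Lemma ex_nonzero_hom M N :
  (\sum_a \dim {: M (src a)} * \dim {: N (tgt a)} <
   \sum_i \dim {: M i} * \dim {: N i})%N ->
  exists2 f : (forall i, 'Hom(M i, N i)), rep_hom f & exists i x, f i x <> 0.
Proof.
move=> dimMN.
have [n [e [r eK]]] := ex_embeddings M.
have [n' [e' [r' eK']]] := ex_embeddings N.
pose E : vectType k := 'Hom('rV[k]_n, 'rV[k]_n').
(* All the spaces Hom(M_i, N_j) are embedded by [T i j] into the single space [E], so that both
   direct sums become spaces of families in [E]; [D] below is then the defect of commutation with
   the arrows. *)
have linT i j : linear (fun h : 'Hom(M i, N j) => (e' j \o (h \o r i))%VF : E).
  by move=> c x y; rewrite comp_lfunDl -comp_lfunZl comp_lfunDr -comp_lfunZr.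
pose T i j := sval (ex_lfun (linT i j)).
have TE i j h : T i j h = (e' j \o (h \o r i))%VF by rewrite /T; case: ex_lfun.
have dimT i j : \dim (limg (T i j)) = (\dim {: M i} * \dim {: N j})%N.
  rewrite limg_dim_eq ?dimvf //; apply/eqP; rewrite -subv0; apply/subvP => h.
  rewrite memv_cap memv_ker memv0 TE => /andP[_ /eqP h0].
  apply/eqP/lfunP => x; have := congr1 (fun g : E => r' j (g (e i x))) h0.
  by rewrite !comp_lfunE eK eK' !zero_lfunE linear0.
pose F a : 'End('rV[k]_n) := (e (tgt a) \o (rep_map M a \o r (src a)))%VF.
pose G a : 'End('rV[k]_n') := (e' (tgt a) \o (rep_map N a \o r' (src a)))%VF.
have [|D DE] := @ex_lfun k {ffun vertex Q -> E} {ffun arrow Q -> E} (fun x =>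
   [ffun a => (x (tgt a) \o F a)%VF - (G a \o x (src a))%VF]).
  move=> c x y; apply/ffunP => a; rewrite !ffunE.
  rewrite comp_lfunDl comp_lfunDr -comp_lfunZl -comp_lfunZr scalerBr.
  by rewrite opprD addrACA.
pose W := ffunv (fun i : vertex Q => limg (T i i)).
pose W' := ffunv (fun a : arrow Q => limg (T (src a) (tgt a))).
have DW : (D @: W <= W')%VS.
  apply/subvP => _ /memv_imgP[x /memv_ffunv xW ->]; apply/memv_ffunv => a.
  rewrite DE ffunE.
  have /memv_imgP[ht _ ->] := xW (tgt a); have /memv_imgP[hs _ ->] := xW (src a).
  apply/memv_imgP.
  exists ((ht \o rep_map M a) - (rep_map N a \o hs))%VF; first exact: memvf.
  rewrite linearB /= !TE; apply/lfunP => y.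
  by rewrite !add_lfunE !opp_lfunE !comp_lfunE eK eK'.
pose x := vpick (W :&: lker D)%VS.
have x0 : x != 0.
  rewrite vpick0 -dimv_eq0 -lt0n.
  have := limg_ker_dim D W; have := dimvS DW; rewrite !dim_ffunv.
  under eq_bigr do rewrite dimT; under [X in _ -> _ = X -> _]eq_bigr do rewrite dimT.
  move=> le1 eq1; rewrite lt0n; apply/negP => /eqP d0; move: eq1; rewrite d0 add0n => eq1.
  by move: dimMN; rewrite -eq1 ltnNge le1.
have /memv_capP[/memv_ffunv xW] : x \in (W :&: lker D)%VS by exact: memv_pick.
rewrite memv_ker DE => /eqP/ffunP xD.
pose h i : 'Hom(M i, N i) := (r' i \o (x i \o e i))%VF.
have hx i : x i = T i i (h i).
  have /memv_imgP[g _ xg] := xW i; rewrite xg; congr (T i i _); apply/lfunP => y.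
  by rewrite !comp_lfunE xg TE !comp_lfunE eK eK'.
exists h.
  apply/rep_homE => a y; have := xD a; rewrite !ffunE => /eqP.
  rewrite subr_eq0 => /eqP/(congr1 (fun g : E => r' (tgt a) (g (e (src a) y)))).
  by rewrite !hx !TE !comp_lfunE !eK !eK'.
apply: contrapT => nh; case/eqP: x0; apply/ffunP => i; rewrite ffunE hx TE.
apply/lfunP => y; rewrite comp_lfunE [(h i \o r i)%VF y]comp_lfunE zero_lfunE.
suff -> : h i (r i y) = 0 by rewrite linear0.
by apply: contrapT => hy; apply: nh; exists i, (r i y).
Qed.

End EulerForm.

(** Connectedness of the diagram, in a form suited to induction on the vertex number. *)
Lemma dynkin_edge_parent (X : dynkin) m : dynkin_valid X ->
  (0 < m < dynkin_rank X)%N -> exists2 l, (l < m)%N & dynkin_edge X l m.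
Proof.
move=> vX /andP[m0 mX]; rewrite /dynkin_edge.
case: (eqVneq m.+1 (dynkin_rank X)) => [mE|_]; last first.
  by exists m.-1; rewrite prednK ?leqnn //= eqxx.
suff jm : (dynkin_joint X < m)%N by exists (dynkin_joint X); rewrite ?jm //= eqxx.
by case: X vX mX mE m0 => [n|n|||] /= vX mX mE m0; lia.
Qed.

(** * Dynkin quivers: equal norms and the Tits form *)

Section DynkinQuiver.

Variables (Q : quiver) (X : dynkin) (phi : vertex Q -> 'I_(dynkin_rank X)).
Hypothesis hQ : underlying_dynkin phi.
Variables (R : realType) (V : vectType R) (form : {dot V for idfun}).
Variables (Phi : seq V) (alpha : vertex Q -> V).
Hypotheses (hPhi : is_root_system form Phi) (halpha : is_simple_system alpha Phi).
Hypothesis hX : simple_roots_of_type form alpha phi.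
Notation src := (@source Q).
Notation tgt := (@target Q).

(** For joined vertices both Cartan numbers are -1, which forces equal norms; every vertex descends
    along edges to vertex 0. *)
Lemma dynkin_simple_norm i j : form (alpha i) (alpha i) = form (alpha j) (alpha j).
Proof.
have [vX [psi phiK psiK] _] := hQ.
have rank_gt0 : (0 < dynkin_rank X)%N by apply: leq_ltn_trans (ltn_ord (phi i)).
pose o := psi (Ordinal rank_gt0).
suff H l : form (alpha l) (alpha l) = form (alpha o) (alpha o) by rewrite !H.
have [m] := ubnP (phi l); elim: m l => // m IHm l lm.
have [l0|l0] := posnP (phi l).
  have -> // : l = o by rewrite -[LHS]phiK; congr psi; apply: val_inj.
have [|p pl e] := @dynkin_edge_parent X (phi l) vX; first by rewrite l0 ltn_ord.
pose p' := Ordinal (ltn_trans pl (ltn_ord (phi l))).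
rewrite -(IHm (psi p')); last by rewrite psiK /= (leq_trans pl).
have aij : dynkin_adj p' (phi l) by rewrite /dynkin_adj /= e.
have aji : dynkin_adj (phi l) p' by rewrite /dynkin_adj /= e orbT.
have pl' : p' != phi l by rewrite -val_eqE /= neq_ltn pl.
have := hX l (psi p'); have := hX (psi p') l.
rewrite /cartan psiK (negPf pl') eq_sym (negPf pl') aij aji /=.
rewrite /cartan_number (dotC form (alpha (psi p'))).
have n1 := form_gt0 form (root_neq0 hPhi (simple_root halpha l)).
have n2 := form_gt0 form (root_neq0 hPhi (simple_root halpha (psi p'))).
move=> /(canRL (divfK (lt0r_neq0 n1))) e1 /(canRL (divfK (lt0r_neq0 n2))) e2.
have c0 : (- 1%:Z)%:~R != 0 :> R by rewrite rmorphN oppr_eq0 oner_eq0.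
by move: e1; rewrite e2 => /(mulfI c0) ->.
Qed.

Lemma quiver_noloop a : src a != tgt a.
Proof.
have [_ _ /(_ (src a) (src a))] := hQ.
rewrite /dynkin_adj /dynkin_edge ltnn /= => /eqP; rewrite cards_eq0 => /eqP E.
by apply/eqP => st; have := in_set0 a; rewrite -E inE -st !eqxx.
Qed.

Lemma cartan_number_sum (d : vertex Q -> R) u :
  cartan_number form (\sum_i d i *: alpha i) (alpha u) =
  2 * d u - \sum_a ((tgt a == u)%:R * d (src a) + (src a == u)%:R * d (tgt a)).
Proof.
have cE : cartan_number form (\sum_i d i *: alpha i) (alpha u) =
    \sum_i d i * (cartan (phi i) (phi u))%:~R.
  rewrite /cartan_number linear_sumlz /= mulr_sumr mulr_suml.
  apply: eq_bigr => i _; rewrite -hX /cartan_number linearZl_LR /=.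
  by rewrite !mulrA (mulrC 2 (d i)).
have [_ [psi phiK psiK] card_adj] := hQ.
have phi_inj : injective phi := can_inj phiK.
have adjE i : (dynkin_adj (phi i) (phi u))%:R =
    \sum_a (((src a == i) && (tgt a == u)) || ((src a == u) && (tgt a == i)))%:R :> R.
  rewrite -card_adj cardsE -sum1_card natr_sum big_mkcond /=.
  by apply: eq_bigr => a _; rewrite unfold_in; case: ifP.
have cartanE i : (cartan (phi i) (phi u))%:~R =
    (if i == u then 2 else 0) - (dynkin_adj (phi i) (phi u))%:R :> R.
  rewrite /cartan (inj_eq phi_inj); case: eqP => [->|_]; last first.
    by rewrite sub0r rmorphN.
  by rewrite /dynkin_adj /dynkin_edge ltnn subr0.
rewrite cE (eq_bigr (fun i => (if i == u then d i * 2 else 0) -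
  \sum_a d i * (((src a == i) && (tgt a == u)) || ((src a == u) && (tgt a == i)))%:R)).
  rewrite sumrB -big_mkcond big_pred1_eq mulrC exchange_big /=; congr (_ - _).
  apply: eq_bigr => a _; have st := quiver_noloop a.
  rewrite (eq_bigr (fun i => (if i == src a then (tgt a == u)%:R * d i else 0) +
     (if i == tgt a then (src a == u)%:R * d i else 0))).
    by rewrite big_split /= -!big_mkcond !big_pred1_eq.
  move=> i _; rewrite [src a == i]eq_sym [tgt a == i]eq_sym.
  case: (eqVneq i (src a)) => [->|_] /=.
    by rewrite (negPf st) andbF orbF addr0 mulrC.
  by rewrite add0r andbC; case: eqP => _; rewrite ?mulr0 //= mulrC.
move=> i _; rewrite cartanE adjE mulrBr mulr_sumr; congr (_ - _).
by case: eqP => _; rewrite ?mulr0.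
Qed.

Lemma dynkin_refl_along : refl_along form alpha src tgt.
Proof.
move=> u d; rewrite reflE -/(cartan_number form _ _) cartan_number_sum.
by rewrite -scaleNr opprB.
Qed.

(** The left side is the Euler form of b with itself. Expanding 2(b, b) by the Cartan numbers gives
    n times twice this value, where n is the norm of the simple roots, and (b, b) = n. *)
Lemma tits_root (d : vertex Q -> R) : \sum_i d i *: alpha i \in Phi ->
  \sum_i d i * d i - \sum_a d (src a) * d (tgt a) = 1.
Proof.
set b := \sum_i _ => bP.
have [u _] : exists u : vertex Q, true.
  case: (pickP (vertex Q)) => [u _|nI]; first by exists u.
  by have := root_neq0 hPhi bP; rewrite /b big_pred0 ?eqxx.
pose n := form (alpha u) (alpha u).
have n0 : n != 0.
  exact: lt0r_neq0 (form_gt0 form (root_neq0 hPhi (simple_root halpha u))).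
have bb : form b b = n := root_norm hPhi halpha dynkin_simple_norm u bP.
have fb i : 2 * form b (alpha i) = n *
   (2 * d i - \sum_a ((tgt a == i)%:R * d (src a) + (src a == i)%:R * d (tgt a))).
  rewrite -cartan_number_sum /cartan_number (dynkin_simple_norm i u) -/n.
  by rewrite [RHS]mulrCA divff ?mulr1.
have : 2 * form b b = \sum_i n * (d i * (2 * d i -
   \sum_a ((tgt a == i)%:R * d (src a) + (src a == i)%:R * d (tgt a)))).
  rewrite {2}/b linear_sumr mulr_sumr; apply: eq_bigr => i _.
  by rewrite linearZr_LR /= mulrCA fb mulrCA.
rewrite bb -mulr_sumr mulrC => /(mulfI n0).
under [in RHS]eq_bigr do rewrite mulrBr mulrCA.
rewrite sumrB -mulr_sumr => tE.
have aE : \sum_i d i *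
   (\sum_a ((tgt a == i)%:R * d (src a) + (src a == i)%:R * d (tgt a))) =
   2 * \sum_a d (src a) * d (tgt a).
  under eq_bigr do rewrite mulr_sumr.
  rewrite exchange_big mulr_sumr /=; apply: eq_bigr => a _.
  rewrite (eq_bigr (fun i => (if i == tgt a then d i * d (src a) else 0) +
     (if i == src a then d i * d (tgt a) else 0))).
    rewrite big_split /= -!big_mkcond !big_pred1_eq; ring.
  move=> i _; rewrite mulrDr [tgt a == i]eq_sym [src a == i]eq_sym.
  by congr (_ + _); case: eqP => _; rewrite ?mul1r // mul0r mulr0.
move: tE; rewrite aE; lra.
Qed.

End DynkinQuiver.

(** * The torsion-free class *)

Section TorsionFreeClass.

Variables (k : fieldType) (Q : quiver) (X : dynkin).
Variable phi : vertex Q -> 'I_(dynkin_rank X).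
Hypothesis hQ : underlying_dynkin phi.
Variables (R : realType) (V : vectType R) (form : {dot V for idfun}).
Variables (Phi : seq V) (alpha : vertex Q -> V).
Hypotheses (hPhi : is_root_system form Phi) (halpha : is_simple_system alpha Phi).
Hypothesis hX : simple_roots_of_type form alpha phi.
Variable s : seq (vertex Q).
Local Notation w := (word_prod form alpha s).
Hypothesis s_reduced : size s = weyl_length form alpha w.
Hypothesis s_adm : admissible (@source Q) (@target Q) s.
Local Notation inv := (inversion alpha Phi w).
Local Notation F := (@FQ k Q R V alpha Phi w).
Implicit Types L M N : rep k Q.

Let nrm := dynkin_simple_norm hQ hPhi halpha hX.
Let along := dynkin_refl_along hQ hX.

Lemma FQE M : F M <-> exists2 t,
  all_reps (fun N => indecomposable N /\ inv (dimvec alpha N)) t &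
  rep_iso M (rep_bigsum t).
Proof. exact: add_dimvecE. Qed.

Lemma inv_roots b : b \in word_roots form alpha s <-> inv b.
Proof. exact: (word_roots_inversion hPhi halpha). Qed.

(** It suffices to treat each indecomposable summand [N] of [L]: it embeds into a sum of
    indecomposables of the class, whose coordinates separate its points, and [closed_cogenerated]
    puts its dimension vector among the inversions. *)
Lemma FQ_sub L M (f : forall i, 'Hom(L i, M i)) : rep_hom f ->
  (forall i, injective (f i)) -> F M -> F L.
Proof.
move=> fh fI /FQE[t tP /rep_isoE[g [g1 [gh _ gK _]]]]; apply/FQE.
have [l lP iso] := krull_schmidt L; exists l => //.
have /rep_isoE[g' [g1' [gh' _ gK' _]]] := rep_iso_sym iso.
apply: all_reps_impl (bigsum_summand lP) => N [indN [h [hh hI]]]; split=> //.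
pose m i := (g i \o (f i \o (g' i \o h i)))%VF.
have mh : rep_hom m by do 3! apply: rep_hom_comp => //.
have mI i x : m i x = 0 -> x = 0.
  rewrite !comp_lfunE -(linear0 (g i)) => /(can_inj (gK i)).
  rewrite -(linear0 (f i)) => /(fI i).
  by rewrite -(linear0 (g' i)) => /(can_inj (gK' i)); rewrite -(linear0 (h i)) => /(hI i).
have [E [e [r mE]]] := ex_model N.
rewrite -(models_dimvec mE); apply/inv_roots.
apply: (closed_cogenerated (simple_free halpha) s_adm along).
- exact: models_stable mE.
- exact/(models_connected mE)/indecomposable_connected.
move=> i y yE y0; have [eK rK eE em] := mE.
have mx : m i (r i y) <> 0.
  by move/mI => ry0; case/eqP: y0; rewrite -[y](rK i) // ry0 linear0.
have [N' [p [[indN' invN'] ph px]]] := bigsum_separated tP mx.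
have [E' [e' [r' mE']]] := ex_model N'.
exists E', (fun i => (e' i \o ((p i \o m i)%VF \o r i))%VF); split.
- exact: models_stable mE'.
- exact/(models_connected mE')/indecomposable_connected.
- by rewrite (models_dimvec mE'); apply/inv_roots.
- exact: models_hom mE mE' (rep_hom_comp ph mh).
- have [eK' _ _ _] := mE'; apply/eqP; rewrite comp_lfunE comp_lfunE (comp_lfunE (p i)).
  by rewrite -(linear0 (e' i)) => /(can_inj (eK' i)).
Qed.

Lemma FQ_indecomposable M : indecomposable M -> inv (dimvec alpha M) -> F M.
Proof.
move=> indM invM; apply/FQE; exists [:: M] => //=.
exact/rep_iso_sym/rep_sum0r.
Qed.

Lemma inv_realized b : inv b ->
  exists M, [/\ indecomposable M, dimvec alpha M = b & F M].
Proof.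
move=> invb; have [E [stE indE dE]] : exists E : erep k (vertex Q) (arrow Q),
    [/\ estable (@source Q) (@target Q) E, eindec (@source Q) (@target Q) E &
        edimvec alpha E = b].
  apply: (word_roots_realized k (simple_free halpha) s_adm along).
    exact: (reduced_nonneg_word hPhi halpha).
  exact/inv_roots.
have [M [e [r mE]]] := ex_modelled stE.
have indM : indecomposable M.
  exact/connected_indecomposable/(models_connected mE).
have dM : dimvec alpha M = b by rewrite -(models_dimvec mE).
by exists M; split=> //; apply: FQ_indecomposable; rewrite // dM.
Qed.

Lemma simple_hom M N (f : forall i, 'Hom(M i, N i)) :
  simple_object F M -> F N -> rep_hom f ->
  (forall i x, f i x = 0) \/ forall i, injective (f i).
Proof.
move=> [FM M0 simM] FN fh; have [L LE [g gh gI]] := ex_kernel_rep fh.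
case: (pselect (forall i, L i = 0%VS)) => [L0|L0].
  by right=> i; apply/lker0P; rewrite -LE L0.
case: (pselect (forall i, L i = fullv)) => [L1|L1].
  by left=> i x; apply/eqP; rewrite -memv_ker -LE L1 memvf.
case: simM; exists L; split=> //; last exact: FQ_sub gh gI FN.
by apply: FQ_sub (@incl_rep_hom _ _ _ L) _ FM => i x y; rewrite !incl_repE => /subvs_inj.
Qed.

(** An idempotent endomorphism of a simple object is zero or injective, and an injective idempotent
    is the identity. The decomposition witnessing [F M] then has a single nonzero term. *)
Lemma simple_indecomposable M : simple_object F M ->
  indecomposable M /\ inv (dimvec alpha M).
Proof.
move=> simM; have [FM M0 _] := simM.
have indM : indecomposable M.
  apply: connected_indecomposable; split=> // e eh eK.
  by case: (simple_hom simM FM eh) => [|eI]; [left|right=> i x; apply: eI].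
split=> //; have /FQE[[|N t] tP iso] := FM.
  by case: M0 => i; exact: etrans (rep_iso_dim iso i) (dim_rep0 k i).
have [[[N0 _] invN] _] := tP; have [_ /(_ N (rep_bigsum t) iso)] := indM.
by case=> // t0; rewrite (dimvec_iso _ iso) /= dimvec_sum (dimvec_rep0 _ t0) addr0.
Qed.

Lemma dimvec_dim M N i : dimvec alpha M = dimvec alpha N ->
  \dim {: M i} = \dim {: N i}.
Proof. by move/(simple_free halpha)/(_ i)/eqP; rewrite eqr_nat => /eqP. Qed.

Lemma inv_root b : inv b -> b \in Phi.
Proof. by case=> -[]. Qed.

Lemma tits_dim M : inv (dimvec alpha M) ->
  (\sum_i \dim {: M i} * \dim {: M i} =
   (\sum_a \dim {: M (source a)} * \dim {: M (target a)}).+1)%N.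
Proof.
move=> /inv_root /(tits_root hQ hPhi halpha hX) tE.
move: tE => /=; under eq_bigr do rewrite -natrM.
under [X in _ - X]eq_bigr do rewrite -natrM.
by rewrite -!natr_sum => /eqP; rewrite subr_eq addrC natr1 eqr_nat => /eqP.
Qed.

Lemma simple_bruhat M : simple_object F M ->
  bruhat_inversion form alpha Phi w (dimvec alpha M).
Proof.
move=> simM; have [indM invM] := simple_indecomposable simM.
apply/(bruhat_inversionE hPhi halpha nrm); split=> // -[g [d [invg invd gd]]].
have [G [_ dG FG]] := inv_realized invg; have [D [_ dD FD]] := inv_realized invd.
have dimM i : \dim {: M i} = (\dim {: G i} + \dim {: D i})%N.
  by rewrite -dim_rep_sum; apply: dimvec_dim; rewrite dimvec_sum dG dD.
have dimI N (f : forall i, 'Hom(M i, N i)) i : injective (f i) ->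
    (\dim {: M i} <= \dim {: N i})%N.
  move=> /lker0P/eqP fI; rewrite -(@limg_dim_eq _ _ _ (f i)) ?dimvS ?subvf //.
  by rewrite fI capv0.
have b_neq0 N : inv (dimvec alpha N) -> ~ rep_is0 N.
  move=> /inv_root/(root_neq0 hPhi)/eqP nN /(dimvec_rep0 alpha); exact: nN.
(* In terms of the Euler form, <b, g> and <b, d> are both at most 0, since [M] is strictly larger
   than [G] and [D] and admits no injection into them; this contradicts <b, b> = 1. *)
have noM N N' : F N -> (forall i, \dim {: M i} = \dim {: N i} + \dim {: N' i})%N ->
    inv (dimvec alpha N') ->
    (\sum_i \dim {: M i} * \dim {: N i} <=
     \sum_a \dim {: M (source a)} * \dim {: N (target a)})%N.
  move=> FN dMN /b_neq0 N'0; rewrite leqNgt; apply/negP.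
  move=> /ex_nonzero_hom[f fh [i [x fx]]].
  case: (simple_hom simM FN fh) => [f0|fI]; first exact/fx/f0.
  case: N'0 => j; have := dimI N f j (fI j); rewrite dMN.
  by rewrite -{2}[\dim {: N j}]addn0 leq_add2l leqn0 => /eqP.
have e1 : (\sum_i \dim {: M i} * \dim {: M i} =
    \sum_i \dim {: M i} * \dim {: G i} + \sum_i \dim {: M i} * \dim {: D i})%N.
  by rewrite -big_split /=; apply: eq_bigr => i _; rewrite -mulnDr -dimM.
have e2 : (\sum_a \dim {: M (source a)} * \dim {: M (target a)} =
    \sum_a \dim {: M (source a)} * \dim {: G (target a)} +
    \sum_a \dim {: M (source a)} * \dim {: D (target a)})%N.
  by rewrite -big_split /=; apply: eq_bigr => a _; rewrite -mulnDr -dimM.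
have tE := tits_dim invM; rewrite e1 e2 in tE.
have h1 := noM G D FG dimM; rewrite dD in h1.
have h2 := noM D G FD (fun i => etrans (dimM i) (addnC _ _)); rewrite dG in h2.
have := leq_add (h1 invd) (h2 invg); by rewrite tE ltnn.
Qed.

Lemma simple_iso M N : simple_object F M -> simple_object F N ->
  dimvec alpha M = dimvec alpha N -> rep_iso M N.
Proof.
move=> simM simN dMN; have dimMN i := dimvec_dim i dMN.
have [_ invM] := simple_indecomposable simM.
have [f fh [i [x fx]]] : exists2 f : (forall i, 'Hom(M i, N i)), rep_hom f &
    exists i x, f i x <> 0.
  apply: ex_nonzero_hom.
  rewrite -(eq_bigr _ (fun i _ => congr1 (muln (\dim {: M i})) (dimMN i))).
  rewrite tits_dim // ltnS; apply: eq_leq; apply: eq_bigr => a _.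
  by rewrite (dimMN (target a)).
have [FN _ _] := simN; case: (simple_hom simM FN fh) => [f0|fI].
  by case: fx; apply: f0.
exact: rep_iso_inj fh fI dimMN.
Qed.

Lemma bruhat_simple b : bruhat_inversion form alpha Phi w b ->
  exists2 M, simple_object F M & dimvec alpha M = b.
Proof.
move=> /(bruhat_inversionE hPhi halpha nrm)[invb nsum].
have [M [[M0 _] dM FM]] := inv_realized invb; exists M => //; split=> //.
move=> [L [L0 L1 /FQE[t1 t1P iso1] /FQE[t2 t2P iso2]]]; apply: nsum.
(* [L] is neither zero nor all of [M], so the submodule and the quotient each contribute at least
   one inversion, as [sum_root_split] requires of the total. *)
have t1_gt0 : (0 < size t1)%N.
  case: t1 t1P iso1 => // _ iso1; case: L0 => i; apply/eqP; rewrite -dimv_eq0.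
  have := etrans (rep_iso_dim iso1 i) (dim_rep0 k i).
  by rewrite dimvf -[dim _]/(\dim (L i)) => ->.
have t2_gt0 : (0 < size t2)%N.
  case: t2 t2P iso2 => // _ iso2; case: L1 => i; apply/eqP; rewrite eqEdim subvf.
  have := etrans (rep_iso_dim iso2 i) (dim_rep0 k i); rewrite dimvf => /eqP.
  by rewrite -[dim _]/(\dim (L i)^C) dimv_compl subn_eq0.
pose t := t1 ++ t2; have tP := all_reps_cat t1P t2P.
apply: (sum_root_split hPhi halpha nrm (J := 'I_(size t))
  (F := fun j => dimvec alpha (nth (rep0 k Q) t j))).
- exact: inv_root.
- by move=> j; have [] := all_reps_nth tP (ltn_ord j).
- by rewrite card_ord size_cat -(addn1 1) leq_add.
rewrite -dM (dimvec_sub_quot alpha L) (dimvec_iso _ iso1) (dimvec_iso _ iso2).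
rewrite !dimvec_bigsum -big_cat (big_nth (rep0 k Q)) big_mkord.
by [].
Qed.

End TorsionFreeClass.

Theorem theoremB (k : fieldType)
    (Q : quiver) (X : dynkin) (phi : vertex Q -> 'I_(dynkin_rank X))
    (hQ : underlying_dynkin phi)
    (R : realType) (V : vectType R) (form : {dot V for idfun})
    (Phi : seq V) (alpha : vertex Q -> V)
    (hPhi : is_root_system form Phi) (halpha : is_simple_system alpha Phi)
    (hX : simple_roots_of_type form alpha phi)
    (c : seq (vertex Q)) (hc : coxeter_word c)
    (w : 'End(V)) (hw : sortable form alpha c w) :
  let simple := @simple_object k Q (FQ alpha Phi w) in
  [/\ forall M, simple M -> bruhat_inversion form alpha Phi w (dimvec alpha M),
      forall M N, simple M -> simple N ->
        (rep_iso M N <-> dimvec alpha M = dimvec alpha N)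
    & forall b, bruhat_inversion form alpha Phi w b ->
        exists2 M, simple M & dimvec alpha M = b].
Proof.
have [_ [cs [csc csn <- red]]] := hw; have [uc _ ltc] := hc.
(* The order of the letters in the Coxeter word and the nesting of the supports enter only here;
   afterwards the word [flatten cs] is used through its reducedness and admissibility. *)
have adm : admissible (@source Q) (@target Q) (flatten cs).
  apply: admissible_alternating => a; first exact: (quiver_noloop hQ).
  apply: alternating_sortable uc (ltc a) csc csn.
  by rewrite eq_sym (quiver_noloop hQ).
split=> [M|M N simM simN|b].
- exact: (simple_bruhat hQ hPhi halpha hX red adm).
- split; first exact: dimvec_iso.
  exact: (simple_iso hQ hPhi halpha hX red adm).
- exact: (bruhat_simple k hQ hPhi halpha hX red adm).
Qed.
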